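(* For a fixed prime $p\geq 3$ and fixed $j$ with $0<j<p$, the dimensions of the following vector spaces grow for $g\to\infty$ as $$\dim(\mathcal V^{I}_p(\Sigma_g))\sim \mathrm{const.}\cdot\|\mathsf F_p\|^g\qquad\text{and}\qquad \dim(\overline{\mathcal V}^{(j)}_p(\Sigma_g))\sim\mathrm{const.}\cdot\|\mathsf f_p\|^g,$$ where $$\|\mathsf F_p\|=\frac{p}{4\sin^2(\pi/p)}\qquad\text{and}\qquad\|\mathsf f_p\|=4\cos^2\!\Big(\frac{\pi}{2p}\Big).$$ Moreover, there are polynomials $R_p(f)\in\mathbb Z[f]$ of degree $\deg(R_p)=\frac{p-3}{2}$ with $$\|\mathsf F_p\|=R_p(\|\mathsf f_p\|).$$
   Context: $u_g\sim\mathrm{const.}\cdot\lambda^g$ means that $u_g/\lambda^g$ converges to a positive constant as $g\to\infty$. $\Sigma_g$ is the closed connected oriented surface of genus $g$, $H=H_1(\Sigma_g,\mathbb Z)$ with symplectic basis $a_1,\dots,a_g,b_1,\dots,b_g$, $\omega=\sum_ia_i\wedge b_i$. Equip $\bigwedge^*H$ with the inner product for which monomials in the $a_i,b_i$ are orthonormal; put $E\alpha=\alpha\wedge\omega$, $F=E^*$. For $j\ge1$ let $\mathcal V^{(j)}_{\mathbb Z}(\Sigma_g)=\{v\in\bigwedge^{g-j+1}H:Fv=0\}$, $\mathcal V^{(j)}_p(\Sigma_g)$ its reduction mod $p$, and $\overline{\mathcal V}^{(j)}_p(\Sigma_g)$ the quotient of $\mathcal V^{(j)}_p(\Sigma_g)$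 by the null space of the induced $\mathbb F_p$-valued bilinear form. $\mathcal V^I_p$ is the TQFT over $\mathbb F_p$ obtained from the Reshetikhin–Turaev TQFT $\mathcal V^{RT}_{\zeta_p}$ for $U_{\zeta_p}(\mathfrak{so}_3)$ at a $p$-th root of unity, written over $\mathbb Z[\zeta_p]$, by the ring reduction $\mathbb Z[\zeta_p]\to\mathbb F_p$, $\zeta_p\mapsto1$. Its dimensions are those of $\mathcal V_{\zeta_p}^{RT}$, given by the Verlinde formula: $\dim\mathcal V^I_p(\Sigma_g)$ is the coefficient of $\langle1\rangle$ in $\mathsf F_p^g$, where $\mathsf F_p=\sum_{i=0}^{(p-3)/2}\langle2i+1\rangle^2$ in the fusion ring $\Phi_p$, the commutative ring with $\mathbb Z$-basis $\langle1\rangle,\dots,\langle p-1\rangle$, unit $\langle1\rangle$, and $\langle2\rangle\langle k\rangle=\langle k-1\rangle+\langle k+1\rangle$ for $1<k<p-1$, $\langle p-1\rangle\langle k\rangle=\langle p-k\rangle$. *)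

(* Defs.v *)
From HB Require Import structures.
From mathcomp Require Import all_boot all_order all_algebra.
From mathcomp Require Import all_classical all_reals all_analysis.
Import numFieldNormedType.Exports.

Set Implicit Arguments.
Unset Strict Implicit.
Unset Printing Implicit Defensive.

Import Order.TTheory GRing.Theory Num.Theory.

Local Open Scope ring_scope.

(* u_g ~ const * lam^g *)
Definition grows_as (R : realType) (u : nat -> R) (lam : R) : Prop :=
  exists2 c : R, 0 < c & ((fun g => u g / lam ^+ g) @ \oo --> c)%classic.

(* The free Z-module on <1>, ..., <p-1>; the coordinate of <k> has index k-1.  *)
Definition fusion (p : nat) : Type := 'rV[int]_(p.-1).

HB.instance Definition _ (p : nat) := GRing.Zmodule.on (fusion p).

(* <k>, with <k> = 0 for k = 0 and for k >= p. *)
Definition fus (p k : nat) : fusion p := \row_(i < p.-1) (i.+1 == k)%:R.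

(* Right multiplication by fus_two p is <k> |-> <k-1> + <k+1>. *)
Definition fus_two (p : nat) : 'M[int]_(p.-1) :=
  \matrix_(i, j) ((j.+1 == i)%:R + (nat_of_ord j == i.+1)%:R).

(* Multiplication by <k>: the recursion is <k+2> = <2><k+1> - <k>. *)
Fixpoint fus_op (p k : nat) : 'M[int]_(p.-1) :=
  match k with
  | 0 => 0
  | k'.+1 => match k' with
             | 0 => 1%:M
             | k''.+1 => fus_op p k' *m fus_two p - fus_op p k''
             end
  end.

Definition fus_rho (p : nat) (x : fusion p) : 'M[int]_(p.-1) :=
  \sum_(k < p.-1) x 0 k *: fus_op p k.+1.

Definition fus_mul (p : nat) (x y : fusion p) : fusion p := y *m fus_rho x.

Lemma fus_opS p k : fus_op p k.+2 = fus_op p k.+1 *m fus_two p - fus_op p k.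
Proof. by []. Qed.

Lemma fus_mul_two p k : (0 < k)%N -> (k < p)%N ->
  fus p k *m fus_two p =
  (fus p k.-1 : 'rV_(p.-1)) + (fus p k.+1 : 'rV_(p.-1)).
Proof.
case: k => // k _ kp.
have kp1 : (k < p.-1)%N by case: p kp.
apply/rowP => j; rewrite !mxE (bigD1 (Ordinal kp1)) //= big1 ?addr0.
  by rewrite !mxE eqxx mul1r eqSS.
move=> i /negPf ik; rewrite !mxE eqSS.
have -> : (nat_of_ord i == k) = false by apply: contraFF ik => /eqP ik; apply/eqP/val_inj.
by rewrite mul0r.
Qed.

Lemma fus_opE p k : (k <= p)%N -> fus p 1 *m fus_op p k = fus p k.
Proof.
suff: ((k <= p)%N -> fus p 1 *m fus_op p k = fus p k) /\
      ((k.+1 <= p)%N -> fus p 1 *m fus_op p k.+1 = fus p k.+1) by case.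
elim: k => [|k [IH1 IH2]]; split=> //.
- by move=> _; rewrite mulmx0; apply/rowP => i; rewrite !mxE.
- by move=> _; rewrite mulmx1.
move=> kp; rewrite fus_opS mulmxBr mulmxA IH2 1?ltnW// IH1 1?ltnW 1?ltnW//.
by rewrite fus_mul_two //= [X in X - _]addrC addrK.
Qed.

Lemma fus_rowE p (x : fusion p) : x = \sum_(k < p.-1) x 0 k *: fus p k.+1 :> 'rV_(p.-1).
Proof.
apply/rowP => j; rewrite summxE (bigD1 j) //= big1 ?addr0.
  by rewrite !mxE eqxx mulr1.
move=> i ij; rewrite !mxE eqSS.
have -> : (nat_of_ord j == i) = false.
  by apply: contraNF ij => /eqP ij; apply/eqP/val_inj.
by rewrite mulr0.
Qed.

Lemma fus1_rho p (x : fusion p) : fus p 1 *m fus_rho x = x.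
Proof.
rewrite [RHS]fus_rowE mulmx_sumr; apply: eq_bigr => k _.
by rewrite -scalemxAr fus_opE // (leq_trans (ltn_ord k)) ?leq_pred.
Qed.

Lemma comm_fus_op p (B : 'M[int]_(p.-1)) k :
  comm_mx B (fus_two p) -> comm_mx B (fus_op p k).
Proof.
move=> cB; suff: comm_mx B (fus_op p k) /\ comm_mx B (fus_op p k.+1) by case.
elim: k => [|k [IH1 IH2]]; first by split; [exact: comm_mx0 | exact: comm_mx1].
split=> //; rewrite fus_opS; apply: comm_mxB => //; exact: comm_mxM.
Qed.

Lemma comm_fus_rho p (B : 'M[int]_(p.-1)) x :
  comm_mx B (fus_two p) -> comm_mx B (fus_rho x).
Proof.
move=> cB; apply: comm_mx_sum => k _; rewrite /comm_mx -scalemxAl -scalemxAr.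
by congr (_ *: _); exact: comm_fus_op.
Qed.

Lemma fus_rhoC p (x y : fusion p) : comm_mx (fus_rho x) (fus_rho y).
Proof.
by apply: comm_fus_rho; apply: comm_mx_sym; apply: comm_fus_rho; exact: comm_mx_refl.
Qed.

Lemma fus_op_inj p (B : 'M[int]_(p.-1)) :
  comm_mx B (fus_two p) -> fus p 1 *m B = 0 -> B = 0.
Proof.
move=> cB B0; apply/row_matrixP => k; rewrite row0 rowE.
have -> : delta_mx 0 k = fus p k.+1 :> 'rV_(p.-1).
  by apply/rowP => i; rewrite !mxE eqxx /= eqSS.
rewrite -(@fus_opE p k.+1); last exact: leq_trans (ltn_ord k) (leq_pred p).
by rewrite -mulmxA -(comm_fus_op _ cB) mulmxA B0 mul0mx.
Qed.

Lemma fus_rhoM p (x y : fusion p) : fus_rho (fus_mul x y) = fus_rho y *m fus_rho x.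
Proof.
have cA z : comm_mx (fus_rho z) (fus_two p).
  by apply: comm_mx_sym; apply: comm_fus_rho; exact: comm_mx_refl.
apply/eqP; rewrite -subr_eq0; apply/eqP; apply: fus_op_inj.
  apply: comm_mx_sym; apply: comm_mxB; first exact: comm_mx_sym.
  by apply: comm_mxM; exact: comm_mx_sym.
by rewrite mulmxBr mulmxA !fus1_rho subrr.
Qed.

Lemma fus_mulA p : associative (@fus_mul p).
Proof. by move=> x y z; rewrite /fus_mul fus_rhoM mulmxA. Qed.

Lemma fus_mulC p : commutative (@fus_mul p).
Proof.
move=> x y; rewrite /fus_mul -{1}(fus1_rho y) -[in RHS](fus1_rho x).
by rewrite -!mulmxA fus_rhoC.
Qed.

Lemma fus_mul1 p : left_id (fus p 1) (@fus_mul p).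
Proof. by move=> x; rewrite fus_mulC; exact: fus1_rho. Qed.

Lemma fus_mulDl p : left_distributive (@fus_mul p) +%R.
Proof.
by move=> x y z; rewrite fus_mulC [fus_mul x _]fus_mulC [fus_mul y _]fus_mulC;
  exact: mulmxDl.
Qed.

HB.instance Definition _ (p : nat) := GRing.Zmodule_isComPzRing.Build (fusion p)
  (@fus_mulA p) (@fus_mulC p) (@fus_mul1 p) (@fus_mulDl p).

Lemma fus_unit p : fus p 1 = 1.
Proof. by []. Qed.

Lemma fus_basis p (x : fusion p) : x = \sum_(k < p.-1) fus p k.+1 *~ x 0 k.
Proof.
rewrite [LHS]fus_rowE; apply: eq_bigr => k _.
by rewrite -[X in X *: _]intz; exact: scaler_int.
Qed.

Lemma fus0 p : fus p 0 = 0.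
Proof. by apply/rowP => i; rewrite !mxE. Qed.

Lemma fus_ge p k : (p <= k)%N -> fus p k = 0.
Proof.
move=> pk; apply/rowP => i; rewrite !mxE; case: eqP => // ik.
rewrite -ik in pk; have := leq_trans pk (ltn_ord i).
by case: p i pk {ik} => [[] //|p i _]; rewrite /= ltnn.
Qed.

Lemma fus_rho_op p k : (0 < p)%N -> (k <= p)%N -> fus_rho (fus p k) = fus_op p k.
Proof.
move=> p0 kp; apply/eqP; rewrite -subr_eq0; apply/eqP; apply: fus_op_inj.
  apply: comm_mx_sym; apply: comm_mxB; apply: comm_mx_sym.
    by apply: comm_mx_sym; apply: comm_fus_rho; exact: comm_mx_refl.
  by apply: comm_mx_sym; apply: comm_fus_op; exact: comm_mx_refl.
by rewrite mulmxBr fus1_rho fus_opE // subrr.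
Qed.

Lemma fus2M p k : (0 < k < p)%N -> fus p 2 * fus p k = fus p k.-1 + fus p k.+1.
Proof.
move=> /andP[k0 kp]; have p1 : (1 < p)%N by exact: leq_ltn_trans kp.
rewrite -[LHS]/(fus p k *m fus_rho (fus p 2)) fus_rho_op ?(ltnW p1) //=.
by rewrite mul1mx subr0 fus_mul_two.
Qed.

Lemma fus_lastM p k : (0 < k < p)%N -> fus p p.-1 * fus p k = fus p (p - k).
Proof.
move=> /andP[k0 kp]; have p0 : (0 < p)%N by exact: leq_ltn_trans kp.
rewrite mulrC -[LHS]/(fus p p.-1 *m fus_rho (fus p k)) fus_rho_op ?(ltnW kp) //.
suff: ((k <= p)%N -> fus p p.-1 *m fus_op p k = fus p (p - k)) /\
      ((k.+1 <= p)%N -> fus p p.-1 *m fus_op p k.+1 = fus p (p - k.+1)).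
  by move=> [+ _]; apply; exact: ltnW.
elim: k {k0 kp} => [|k [IH1 IH2]]; split=> //.
- by move=> _; rewrite mulmx0 subn0 fus_ge.
- by move=> _; rewrite mulmx1 subn1.
move=> kp; rewrite fus_opS mulmxBr mulmxA IH2 1?ltnW// IH1 1?ltnW 1?ltnW//.
rewrite fus_mul_two ?subn_gt0 //; last by rewrite ltn_subrL.
have -> : (p - k.+1).+1 = (p - k)%N by rewrite subnSK // ltnW.
by rewrite addrK -subnS.
Qed.

(* The sum runs over i = 0, ..., (p-3)/2. *)
Definition fus_F (p : nat) : fusion p :=
  \sum_(0 <= i < ((p - 3)./2).+1) fus p (2 * i + 1) ^+ 2.

(* The coefficient of <k>. *)
Definition fus_coef (p k : nat) (x : fusion p) : int :=
  \sum_(i < p.-1 | i.+1 == k) x 0 i.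

(* Verlinde formula for the dimension that the SO(3) Reshetikhin-Turaev TQFT at a
   p-th root of unity assigns to a closed surface of genus g; the reduction to F_p
   has the same dimensions. *)
Definition dim_VI (p g : nat) : int := fus_coef 1 (fus_F p ^+ g).

(* The exterior algebra of K^n, in coordinates: the basis is indexed by the
   subsets S of {0, ..., n-1}, and S stands for the wedge product of the basis
   vectors of K^n with index in S, in increasing order. *)
Definition ext (K : comNzRingType) (n : nat) := {ffun {set 'I_n} -> K^o}.

Definition mono (K : comNzRingType) (n : nat) (S : {set 'I_n}) : ext K n :=
  [ffun T => (T == S)%:R].

Definition inversions (n : nat) (S T : {set 'I_n}) : nat :=
  #|[pred st : 'I_n * 'I_n | [&& st.1 \in S, st.2 \in T & (st.2 < st.1)%N]]|.

Definition wedge (K : comNzRingType) (n : nat) (x y : ext K n) : ext K n :=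
  \sum_(S : {set 'I_n}) \sum_(T : {set 'I_n} | [disjoint S & T])
    ((-1) ^+ inversions S T * x S * y T) *: mono K (S :|: T).

Definition inner (K : comNzRingType) (n : nat) (x y : ext K n) : K :=
  \sum_(S : {set 'I_n}) x S * y S.

(* The symplectic basis of H = Z^(g+g) is a_0, ..., a_(g-1), b_0, ..., b_(g-1). *)
Definition symp_a (K : comNzRingType) (g : nat) (i : 'I_g) : ext K (g + g) :=
  mono K [set lshift g i].
Definition symp_b (K : comNzRingType) (g : nat) (i : 'I_g) : ext K (g + g) :=
  mono K [set rshift g i].

Definition omega (K : comNzRingType) (g : nat) : ext K (g + g) :=
  \sum_(i < g) wedge (symp_a K i) (symp_b K i).

Definition opE (K : comNzRingType) (g : nat) (x : ext K (g + g)) : ext K (g + g) :=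
  wedge x (omega K g).

(* The adjoint of opE, written in the orthonormal basis of monomials. *)
Definition opF (K : comNzRingType) (g : nat) (x : ext K (g + g)) : ext K (g + g) :=
  [ffun S => inner (opE (mono K S)) x].

Lemma scale_reg (K : comNzRingType) (a : K) (b : K^o) : a *: b = a * b.
Proof. by []. Qed.

Lemma ext_mono (K : comNzRingType) n (x : ext K n) :
  x = \sum_(S : {set 'I_n}) x S *: mono K S.
Proof.
apply/ffunP => T; rewrite sum_ffunE (bigD1 T) //= big1 ?addr0.
  by rewrite !ffunE eqxx -[RHS]/(_ * _) mulr1.
move=> S ST; rewrite !ffunE eq_sym (negPf ST) -[LHS]/(_ * _); exact: mulr0.
Qed.

Lemma wedge_mono (K : comNzRingType) n (S T : {set 'I_n}) :
  wedge (mono K S) (mono K T) =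
  if [disjoint S & T] then (-1) ^+ inversions S T *: mono K (S :|: T) else 0.
Proof.
rewrite /wedge (bigD1 S) //= [X in _ + X]big1 ?addr0; last first.
  move=> S' S'S; apply: big1 => T' _.
  by rewrite ffunE (negPf S'S) mulr0 mul0r scale0r.
case: ifP => ST; last first.
  apply: big1 => T' ST'; rewrite [mono K T T']ffunE.
  by case: eqP ST' => [->|_ _]; rewrite ?ST // mulr0 scale0r.
rewrite (bigD1 T) //= big1 ?addr0; first by rewrite !ffunE !eqxx !mulr1.
by move=> T' /andP[_ T'T]; rewrite [mono K T T']ffunE (negPf T'T) mulr0 scale0r.
Qed.

Lemma opF_adjoint (K : comNzRingType) g (x y : ext K (g + g)) :
  inner (opE x) y = inner x (opF y).
Proof.
have E : opE x = \sum_S x S *: opE (mono K S).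
  rewrite /opE /wedge; apply: eq_bigr => S _.
  rewrite [in RHS](bigD1 S) //= [X in _ *: (_ + X)]big1 ?addr0.
    rewrite scaler_sumr; apply: eq_bigr => T _.
    by rewrite ffunE eqxx scalerA mulr1 mulrA [x S * _]mulrC.
  move=> S' S'S; apply: big1 => T _.
  by rewrite ffunE (negPf S'S) mulr0 mul0r scale0r.
rewrite E /inner; under eq_bigr => T _ do rewrite sum_ffunE mulr_suml.
rewrite exchange_big; apply: eq_bigr => S _; rewrite ffunE /inner mulr_sumr.
by apply: eq_bigr => T _; rewrite ffunE scale_reg mulrA.
Qed.

(* Membership in the lattice of v in degree g - j + 1 with F v = 0; the degree is
   compared additively, so that the lattice is 0 when j > g + 1. *)
Definition VZ (g j : nat) : pred (ext int (g + g)) := fun v =>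
  [forall S, (v S != 0) ==> (#|S| + j == g + 1)%N] && (opF v == 0).

Arguments VZ : clear implicits.

Definition red (p n : nat) (v : ext int n) : ext 'F_p n :=
  [ffun S => (v S)%:~R].

(* When P is closed under linear combinations, this is the subspace of the v
   that satisfy P. *)
Definition subspace (p n : nat) (P : pred (ext 'F_p n)) : {vspace ext 'F_p n} :=
  <<enum P>>%VS.

(* The lattice is the kernel of an integral operator, hence saturated, so its
   reduction mod p is its image in the exterior algebra over F_p. *)
Definition Vp (p g j : nat) : {vspace ext 'F_p (g + g)} :=
  subspace (fun v => `[< exists2 w, VZ g j w & v = red p w >]).

Definition null_Vp (p g j : nat) : {vspace ext 'F_p (g + g)} :=
  subspace (fun v => (v \in Vp p g j) &&
    [forall w, (w \in Vp p g j) ==> (inner v w == 0)]).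

Lemma mem_subspace (p n : nat) (P : pred (ext 'F_p n)) :
  P 0 -> (forall a u v, P u -> P v -> P (a *: u + v)) ->
  forall v, (v \in subspace P) = P v.
Proof.
move=> P0 PD v; apply/idP/idP => [|Pv]; last first.
  by apply: memv_span; rewrite mem_enum.
move=> /(@coord_span _ _ _ (in_tuple _)) ->.
apply: (big_ind P) => //= [x y Px Py|i _].
  by rewrite -[x]scale1r; exact: PD.
rewrite -[_ *: _]addr0; apply: PD => //.
by have := mem_nth 0 (ltn_ord i); rewrite mem_enum.
Qed.

Lemma opFD g (a : int) (x y : ext int (g + g)) :
  opF (a *: x + y) = a *: opF x + opF y.
Proof.
apply/ffunP => S; rewrite !ffunE /inner scale_reg mulr_sumr -big_split /=.
by apply: eq_bigr => T _; rewrite !ffunE mulrDr scale_reg mulrCA.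
Qed.

Lemma mem_Vp (p g j : nat) (v : ext 'F_p (g + g)) :
  v \in Vp p g j <-> exists2 w, VZ g j w & v = red p w.
Proof.
rewrite /Vp mem_subspace; first by split=> /asboolP.
- apply/asboolP; exists 0; last by apply/ffunP => S; rewrite !ffunE.
  apply/andP; split; first by apply/forallP => S; rewrite ffunE eqxx.
  by have := opFD (-1) 0 (0 : ext int (g + g)); rewrite scaler0 addr0 scaleN1r addNr => ->.
- move=> a u w /asboolP[x /andP[/forallP xd /eqP xF] ->].
  move=> /asboolP[y /andP[/forallP yd /eqP yF] ->]; apply/asboolP.
  exists ((a : nat)%:Z *: x + y).
    apply/andP; split; last by rewrite opFD xF yF scaler0 addr0.
    apply/forallP => S; move: (xd S) (yd S); rewrite !ffunE.
    case: (_ == g + 1)%N; first by rewrite !implybT.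
    by rewrite !implybF !negbK => /eqP-> /eqP->; rewrite scaler0 addr0.
  apply/ffunP => S; rewrite !ffunE !scale_reg rmorphD rmorphM /=.
  by congr (_ * _ + _); rewrite -[LHS]natr_Zp.
Qed.

Lemma mem_null_Vp (p g j : nat) (v : ext 'F_p (g + g)) :
  v \in null_Vp p g j <->
  v \in Vp p g j /\ forall w, w \in Vp p g j -> inner v w = 0.
Proof.
have E (u w : ext 'F_p (g + g)) : inner u w = \sum_S u S * w S by [].
rewrite /null_Vp mem_subspace.
- split=> [/andP[-> /forallP vw]|[-> vw]].
    by split=> // w wV; apply/eqP; move: (vw w); rewrite wV.
  by apply/forallP => w; apply/implyP => /vw ->.
- rewrite mem0v /=; apply/forallP => w; apply/implyP => _; rewrite E big1 // => S _.
  by rewrite ffunE mul0r.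
- move=> a u w /andP[uV /forallP u0] /andP[wV /forallP w0].
  rewrite memvD ?memvZ //=; apply/forallP => x; apply/implyP => xV.
  move: (u0 x) (w0 x); rewrite xV /= => /eqP u0x /eqP w0x.
  rewrite E; under eq_bigr => S _ do rewrite !ffunE mulrDl scale_reg -mulrA.
  by rewrite big_split /= -mulr_sumr -!E u0x w0x mulr0 addr0.
Qed.

(* The dimension of the quotient of Vp by null_Vp. *)
Definition dim_Vbar (p g j : nat) : nat := (\dim (Vp p g j) - \dim (null_Vp p g j))%N.

Definition normF (R : realType) (p : nat) : R :=
  p%:R / (4 * sin (pi / p%:R) ^+ 2).

Definition normf (R : realType) (p : nat) : R :=
  4 * cos (pi / (2 * p%:R)) ^+ 2.

(* Main.v *)
(** Let V_g^j be the lattice of v in degree g - j + 1 with F v = 0.  Splitting off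
the last handle, v = x + y a + z b + w a b lies in V_(g+1)^j iff y, z lie in V_g^j,
w = - F x and F^2 x = 0.  Since F E = j on V_g^(j+1), one has
j x = (j x - E F x) + E F x, which splits V_(g+1)^j orthogonally, up to the p-adic
unit j, into two copies of V_g^j, one of V_g^(j-1) and one of V_g^(j+1), on which
the form is scaled by the units 1, 1 and j (j + 1) respectively, except that
j (j + 1) vanishes mod p when j = p - 1.  Hence the ranks mod p obey the recursion of
multiplication by 2<1> + <2> in the fusion ring, where <0> = <p> = 0, and are given by
the walk count (2/p) sum_m sin(m t) sin(j m t) (2 + 2 cos(m t))^g with t = pi/p,
dominated by m = 1.

The characters <k> |-> sin(k m t) / sin(m t) diagonalize the fusion ring and send
F_p to p / (4 sin^2(m t)), which is largest for m = 1 and m = p - 1.  At m = 1 the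
character identifies <k> and <p-k>, so that F_p becomes a positive combination of
<1>, ..., <(p-1)/2>, and <k> is the Chebyshev polynomial of degree k - 1 in
<2> = |f_p| - 2. *)

Require Import Defs.
From mathcomp Require Import all_boot all_order all_algebra.
From mathcomp Require Import all_classical all_reals all_analysis.
From mathcomp Require Import ring lra zify.
Import numFieldNormedType.Exports.
Import Order.TTheory GRing.Theory Num.Theory.
Local Open Scope ring_scope.

Set Implicit Arguments.
Unset Strict Implicit.
Unset Printing Implicit Defensive.


(** * Sign-free model of the exterior algebra *)

(* The i-th entry of the list records whether a_i and b_i divide the monomial.  Only
   the values on lists of length g matter, so that no bound on the length is kept. *)
Notation cfun := (seq (bool * bool) -> int).

Fixpoint wt (s : seq (bool * bool)) : nat :=
  if s is c :: t then (c.1 + c.2 + wt t)%N else 0%N.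

Definition sect (f : cfun) (c : bool * bool) : cfun := fun t => f (c :: t).

(** The generators are read in the order a_0, b_0, a_1, b_1, ..., so the even factors a_i b_i pass
    every monomial without a sign. *)
Fixpoint sF (f : cfun) (s : seq (bool * bool)) : int :=
  if s is c :: t then
    (if c == (false, false) then f ((true, true) :: t) else 0) + sF (sect f c) t
  else 0.

Fixpoint sE (f : cfun) (s : seq (bool * bool)) : int :=
  if s is c :: t then
    (if c == (true, true) then f ((false, false) :: t) else 0) + sE (sect f c) t
  else 0.

Fixpoint ip (n : nat) (f h : cfun) : int :=
  if n is n'.+1 then
    \sum_(c : bool * bool) ip n' (sect f c) (sect h c)
  else f [::] * h [::].

Lemma sum_bool_pair (V : nmodType) (F : bool * bool -> V) :
  \sum_(c : bool * bool) F c =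
  F (false, false) + F (true, false) + F (false, true) + F (true, true).
Proof.
rewrite (eq_bigr (fun c => F (c.1, c.2))); last by case.
rewrite -(pair_bigA _ (fun a b => F (a, b))) /= !big_bool /=.
by rewrite addrC [X in X + _]addrC [X in _ + X]addrC addrACA addrA.
Qed.

Lemma sF_lin (a b : int) (f h : cfun) s :
  sF (fun u => a * f u + b * h u) s = a * sF f s + b * sF h s.
Proof.
elim: s f h => [|c t IH] f h /=; first by rewrite !mulr0 addr0.
by rewrite (IH (sect f c) (sect h c)); case: ifP => _; ring.
Qed.

Lemma sE_lin (a b : int) (f h : cfun) s :
  sE (fun u => a * f u + b * h u) s = a * sE f s + b * sE h s.
Proof.
elim: s f h => [|c t IH] f h /=; first by rewrite !mulr0 addr0.
by rewrite (IH (sect f c) (sect h c)); case: ifP => _; ring.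
Qed.

Lemma eq_sF (f h : cfun) s :
  (forall u, size u = size s -> f u = h u) -> sF f s = sF h s.
Proof.
elim: s f h => [|c t IH] f h fh //=.
by rewrite fh // (IH (sect f c) (sect h c)) // => u ut; rewrite /sect fh //= ut.
Qed.

Lemma eq_sE (f h : cfun) s :
  (forall u, size u = size s -> f u = h u) -> sE f s = sE h s.
Proof.
elim: s f h => [|c t IH] f h fh //=.
by rewrite fh // (IH (sect f c) (sect h c)) // => u ut; rewrite /sect fh //= ut.
Qed.

Lemma sF0 (f : cfun) s : (forall u, size u = size s -> f u = 0) -> sF f s = 0.
Proof.
move=> f0; have := sF_lin 0 0 f f s; rewrite !mul0r addr0 => <-.
by apply: eq_sF => u /f0 ->; rewrite !mulr0 addr0.
Qed.

Lemma sE0 (f : cfun) s : (forall u, size u = size s -> f u = 0) -> sE f s = 0.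
Proof.
move=> f0; have := sE_lin 0 0 f f s; rewrite !mul0r addr0 => <-.
by apply: eq_sE => u /f0 ->; rewrite !mulr0 addr0.
Qed.

(** The sl_2 relation. Operators of different handles commute, and on one handle the commutator is 1
    on the empty pair, -1 on a_i b_i and 0 on a_i and b_i; these add up to genus minus degree. *)
Lemma comm_sFE (f : cfun) s :
  sF (sE f) s = sE (sF f) s + ((size s)%:Z - (wt s)%:Z) * f s.
Proof.
elim: s f => [|c t IH] f /=; first by rewrite subrr mul0r addr0.
have := IH (sect f c); rewrite /= => IHc.
have D (G : cfun -> seq (bool * bool) -> int) (h1 h2 : cfun) :
    (forall (a b : int) f h s, G (fun u => a * f u + b * h u) s = a * G f s + b * G h s) ->
    (forall (f h : cfun) s, (forall u, size u = size s -> f u = h u) -> G f s = G h s) ->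
    G (fun u => h1 u + h2 u) t = G h1 t + G h2 t.
  move=> GD Ge; rewrite -[G h1 t]mul1r -[G h2 t]mul1r -GD.
  by apply: Ge => u _; rewrite !mul1r.
case: c IHc => [[] []]; rewrite /sect /= => IHc.
- rewrite (D sF _ (sE _) sF_lin eq_sF) IHc.
  rewrite (@eq_sE _ (sF (fun u => f ((true, true) :: u)))); last by move=> u _; rewrite add0r.
  by rewrite /sect (_ : (1 + 1 + wt t)%N%:Z = 2 + (wt t)%:Z) //; lia.
- rewrite (@eq_sE _ (sF (fun u => f ((true, false) :: u)))); last by move=> u _; rewrite add0r.
  rewrite (@eq_sF _ (sE (fun u => f ((true, false) :: u)))); last by move=> u _; rewrite add0r.
  by rewrite IHc; lia.
- rewrite (@eq_sE _ (sF (fun u => f ((false, true) :: u)))); last by move=> u _; rewrite add0r.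
  rewrite (@eq_sF _ (sE (fun u => f ((false, true) :: u)))); last by move=> u _; rewrite add0r.
  by rewrite IHc; lia.
- rewrite (D sE _ (sF _) sE_lin eq_sE).
  rewrite (@eq_sF _ (sE (fun u => f ((false, false) :: u)))); last by move=> u _; rewrite add0r.
  by rewrite IHc /sect; lia.
Qed.

Lemma ipC n f h : ip n f h = ip n h f.
Proof.
elim: n f h => [|n IH] f h /=; first by rewrite mulrC.
by apply: eq_bigr => c _; exact: IH.
Qed.

Lemma ip_linl n (a b : int) (f f' h : cfun) :
  ip n (fun u => a * f u + b * f' u) h = a * ip n f h + b * ip n f' h.
Proof.
elim: n f f' h => [|n IH] f f' h /=; first by ring.
by rewrite !mulr_sumr -big_split /=; apply: eq_bigr => c _; rewrite -IH.
Qed.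

Lemma eq_ip n (f f' h h' : cfun) :
  (forall u, size u = n -> f u = f' u) -> (forall u, size u = n -> h u = h' u) ->
  ip n f h = ip n f' h'.
Proof.
elim: n f f' h h' => [|n IH] f f' h h' ff hh /=; first by rewrite ff // hh.
by apply: eq_bigr => c _; apply: IH => u un; rewrite /sect ?ff ?hh //= un.
Qed.

Lemma ip_scalel n (a : int) (f h : cfun) : ip n (fun u => a * f u) h = a * ip n f h.
Proof.
have := ip_linl n a 0 f f h; rewrite mul0r addr0 => <-.
by apply: eq_ip => // u _; rewrite mul0r addr0.
Qed.

Lemma ip0l n (f h : cfun) : (forall u, size u = n -> f u = 0) -> ip n f h = 0.
Proof.
move=> f0; rewrite -[RHS](mul0r (ip n f h)) -ip_scalel.
by apply: eq_ip => // u /f0 ->; rewrite mulr0.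
Qed.

Lemma ip_adj n (f h : cfun) : ip n (sE f) h = ip n f (sF h).
Proof.
have D m (h1 h2 k : cfun) : ip m (fun u => h1 u + h2 u) k = ip m h1 k + ip m h2 k.
  rewrite -[ip m h1 k]mul1r -[ip m h2 k]mul1r -ip_linl.
  by apply: eq_ip => // u _; rewrite !mul1r.
have Z m (h1 k : cfun) : ip m (fun u => 0 + h1 u) k = ip m h1 k.
  by apply: eq_ip => // u _; rewrite add0r.
elim: n f h => [|n IH] f h /=; first by rewrite mulr0 mul0r.
rewrite !sum_bool_pair /sect /= ![ip n (fun t => f _) _]ipC !Z !D.
rewrite ![ip n _ (fun t => f _)]ipC !IH /sect; ring.
Qed.

Lemma ip_ge0 n f : 0 <= ip n f f.
Proof.
elim: n f => [|n IH] f /=; first by rewrite -expr2 sqr_ge0.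
by apply: sumr_ge0 => c _; exact: IH.
Qed.

Lemma ip_eq0 n f : ip n f f = 0 -> forall u, size u = n -> f u = 0.
Proof.
elim: n f => [|n IH] f /=.
  by move=> /eqP; rewrite mulf_eq0 orbb => /eqP f0 u /size0nil ->.
move=> /eqP; rewrite psumr_eq0; last by move=> c _; exact: ip_ge0.
move=> /allP f0 [|c u] //= [un]; apply: (IH (sect f c)) => //.
by apply/eqP; apply: f0; rewrite mem_index_enum.
Qed.

(* The shift k keeps the degree condition free of truncated subtraction. *)
Definition homog (n k d : nat) (f : cfun) :=
  forall s, size s = n -> f s != 0 -> (wt s + k = d)%N.

Lemma homog_sect n k d f (c : bool * bool) :
  homog n.+1 k d f -> homog n (c.1 + c.2 + k) d (sect f c).
Proof. by move=> hf u un /hf /=; rewrite un => /(_ erefl); lia. Qed.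

Lemma sE_homog n k d f : homog n k d f -> homog n k d.+2 (sE f).
Proof.
elim: n k d f => [|n IH] k d f hf [|c t] //= [st].
have [->|E0 _] := eqVneq (sE (sect f c) t) 0; last first.
  by have := IH _ _ _ (homog_sect hf) _ st E0; lia.
rewrite addr0; case: ifP => [/eqP -> /= /hf|_]; last by rewrite eqxx.
by rewrite /= st => /(_ erefl); lia.
Qed.

Lemma sF_homog n k d f : homog n k d f -> homog n k.+2 d (sF f).
Proof.
elim: n k d f => [|n IH] k d f hf [|c t] //= [st].
have [->|E0 _] := eqVneq (sF (sect f c) t) 0; last first.
  by have := IH _ _ _ (homog_sect hf) _ st E0; lia.
rewrite addr0; case: ifP => [/eqP -> /= /hf|_]; last by rewrite eqxx.
by rewrite /= st => /(_ erefl); lia.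
Qed.

(** * Primitive lattices and splitting off a handle *)

Definition prim (n j : nat) (f : cfun) :=
  homog n j n.+1 f /\ forall s, size s = n -> sF f s = 0.

(** Here E F w = 0 and w has degree n - j, so the commutator acts as the scalar j. *)
Lemma sFE_prim n j w : prim n j.+1 w ->
  forall s, size s = n -> sF (sE w) s = j%:Z * w s.
Proof.
move=> [hw Fw] s sn; rewrite comm_sFE sE0 ?add0r => [|u us]; last by rewrite Fw ?us.
have [->|/hw] := eqVneq (w s) 0; first by rewrite !mulr0.
by move=> /(_ sn) e; congr (_ * _); rewrite sn; lia.
Qed.

(* F E = - 1 here, so |E f|^2 = - |f|^2 and positivity over Z forces f = 0. *)
Lemma prim0 n f : prim n 0 f -> forall s, size s = n -> f s = 0.
Proof.
move=> [hf Ff]; apply: ip_eq0; apply/eqP; rewrite eq_le ip_ge0 andbT.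
rewrite -oppr_ge0 -mulN1r; have -> : -1 * ip n f f = ip n (sE f) (sE f); last exact: ip_ge0.
rewrite ip_adj ipC -ip_scalel; apply: eq_ip => // s sn.
rewrite comm_sFE sE0 ?add0r => [|u us]; last by rewrite Ff ?us.
have [->|/hf] := eqVneq (f s) 0; first by rewrite !mulr0.
by move=> /(_ sn) e; congr (_ * _); rewrite sn; lia.
Qed.

(** The head of the list is the new handle; [emb_a], [emb_b], [emb_0] and [emb_E] produce the four
    summands of the splitting. *)
Definition emb_a (y : cfun) : cfun :=
  fun s => if s is (true, false) :: u then y u else 0.
Definition emb_b (y : cfun) : cfun :=
  fun s => if s is (false, true) :: u then y u else 0.
Definition emb_0 (x : cfun) : cfun :=
  fun s => if s is (false, false) :: u then x u else 0.
(* E w - j w a b. *)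
Definition emb_E (j : nat) (w : cfun) : cfun :=
  fun s => match s with
    | (false, false) :: u => sE w u
    | (true, true) :: u => - j%:Z * w u
    | _ => 0
    end.

Lemma prim_emb_a n j y : prim n j y -> prim n.+1 j (emb_a y).
Proof.
move=> [hy Fy]; split=> [[|[[] []] s]|[|[[] []] s]] //= [sn]; rewrite ?eqxx //=.
- by move=> /hy; lia.
all: by rewrite add0r ?Fy // sF0.
Qed.

Lemma prim_emb_b n j y : prim n j y -> prim n.+1 j (emb_b y).
Proof.
move=> [hy Fy]; split=> [[|[[] []] s]|[|[[] []] s]] //= [sn]; rewrite ?eqxx //=.
- by move=> /hy; lia.
all: by rewrite add0r ?Fy // sF0.
Qed.

Lemma prim_emb_0 n j x : prim n j x -> prim n.+1 j.+1 (emb_0 x).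
Proof.
move=> [hx Fx]; split=> [[|[[] []] s]|[|[[] []] s]] //= [sn]; rewrite ?eqxx //=.
- by move=> /hx; lia.
all: by rewrite add0r ?Fx // sF0.
Qed.

(** The a b coefficient contributes - j w to F, which cancels F E w = j w. *)
Lemma prim_emb_E n j w : prim n j.+1 w -> prim n.+1 j (emb_E j w).
Proof.
move=> pw; have [hw Fw] := pw.
split=> [[|[[] []] s]|[|[[] []] s]] //= [sn]; rewrite ?eqxx //=.
- rewrite mulf_eq0 negb_or => /andP[_ /hw]; lia.
- by move=> /(sE_homog hw); lia.
- rewrite add0r (@eq_sF _ (fun u => - j%:Z * w u + 0 * w u)); last first.
    by move=> u _; rewrite mul0r addr0.
  by rewrite sF_lin Fw // mulr0 mul0r addr0.
- by rewrite add0r sF0.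
- by rewrite add0r sF0.
- by rewrite -[X in _ + X]/(sF (sE w) s) (sFE_prim pw) // mulNr addrC subrr.
Qed.

Lemma prim_sect_a n j f : prim n.+1 j f -> prim n j (sect f (true, false)).
Proof.
move=> [hf Ff]; split=> [s sn /hf|s sn]; first by rewrite /= sn => /(_ erefl); lia.
by have := Ff ((true, false) :: s); rewrite /= sn add0r; apply.
Qed.

Lemma prim_sect_b n j f : prim n.+1 j f -> prim n j (sect f (false, true)).
Proof.
move=> [hf Ff]; split=> [s sn /hf|s sn]; first by rewrite /= sn => /(_ erefl); lia.
by have := Ff ((false, true) :: s); rewrite /= sn add0r; apply.
Qed.

Lemma sect_abE n j f : prim n.+1 j f -> forall s, size s = n ->
  sect f (true, true) s = - sF (sect f (false, false)) s.
Proof.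
move=> [_ Ff] s sn; have := Ff ((false, false) :: s); rewrite /= sn => /(_ erefl) /eqP.
by rewrite addr_eq0 => /eqP.
Qed.

(** With x the part of f free of the new handle, F x is minus the a b coefficient, and F kills that
    coefficient because it kills f; hence F^2 x = 0. *)
Lemma prim_sF_sect n j f : prim n.+1 j f -> prim n j.+1 (sF (sect f (false, false))).
Proof.
move=> pf; have [hf Ff] := pf; split.
  by move=> s sn /(sF_homog (homog_sect hf)) /= /(_ sn); lia.
move=> s sn; rewrite (@eq_sF _ (fun u => -1 * sect f (true, true) u + 0 * f u)); last first.
  by move=> u us; rewrite (sect_abE pf) ?us // mul0r addr0 mulN1r opprK.
rewrite sF_lin; have := Ff ((true, true) :: s); rewrite /= sn add0r => /(_ erefl) ->.
by rewrite mulr0 mul0r.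
Qed.

(** This is j x - E F x: for primitive f, j times the component of x in the kernel of F, scaled to
    stay integral. *)
Definition low (j : nat) (f : cfun) : cfun := fun u =>
  j%:Z * sect f (false, false) u + (-1) * sE (sF (sect f (false, false))) u.

Lemma prim_low n j f : prim n.+1 j.+1 f -> prim n j (low j.+1 f).
Proof.
move=> pf; have [hf Ff] := pf; split.
  move=> s sn; rewrite /low; have [->|/hf /=] := eqVneq (sect f (false, false) s) 0.
    rewrite mulr0 add0r mulN1r oppr_eq0.
    by move=> /(sE_homog (sF_homog (homog_sect hf))) /= /(_ sn); lia.
  by rewrite sn => /(_ erefl); lia.
move=> s sn; rewrite sF_lin (sFE_prim (prim_sF_sect pf)) //; ring.
Qed.

Lemma ip_low n j f : prim n.+1 j f ->
  forall x, (forall s, size s = n -> sF x s = 0) ->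
  ip n (low j f) x = j%:Z * ip n (sect f (false, false)) x.
Proof.
move=> pf x Fx; rewrite ip_linl ip_adj [X in _ + _ * X]ipC [X in _ + _ * X]ip0l ?mulr0 ?addr0 //.
Qed.

Lemma ip0r n (f h : cfun) : (forall u, size u = n -> h u = 0) -> ip n f h = 0.
Proof. by move=> h0; rewrite ipC ip0l. Qed.

Lemma ip_emb_a n f y : ip n.+1 f (emb_a y) = ip n (sect f (true, false)) y.
Proof.
rewrite /= sum_bool_pair (ip0r (sect f (false, false))) // add0r.
by rewrite (ip0r (sect f (false, true))) // (ip0r (sect f (true, true))) // !addr0.
Qed.

Lemma ip_emb_b n f y : ip n.+1 f (emb_b y) = ip n (sect f (false, true)) y.
Proof.
rewrite /= sum_bool_pair (ip0r (sect f (false, false))) // add0r.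
by rewrite (ip0r (sect f (true, false))) // (ip0r (sect f (true, true))) // addr0 add0r.
Qed.

Lemma ip_emb_0 n f y : ip n.+1 f (emb_0 y) = ip n (sect f (false, false)) y.
Proof.
rewrite /= sum_bool_pair (ip0r (sect f (false, true))) //.
by rewrite (ip0r (sect f (true, false))) // (ip0r (sect f (true, true))) // !addr0.
Qed.

(** The two coefficients of [emb_E j w] contribute <x, E w> = <F x, w> and <- F x, - j w>, whence
    the factor j + 1. *)
Lemma ip_emb_E n j f w : prim n.+1 j f ->
  ip n.+1 f (emb_E j w) = (j.+1)%:Z * ip n (sF (sect f (false, false))) w.
Proof.
move=> pf; rewrite /= sum_bool_pair (ip0r (sect f (false, true))) //.
rewrite (ip0r (sect f (true, false))) // !addr0.
rewrite -[X in X + _]/(ip n _ (sE w)) ipC ip_adj ipC.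
rewrite -[X in _ + X]/(ip n _ (fun u => - j%:Z * w u)) [X in _ + X]ipC ip_scalel.
rewrite (@eq_ip _ _ w (sect f (true, true)) (fun u => -1 * sF (sect f (false, false)) u)) //.
  by rewrite [X in _ + _ * X]ipC ip_scalel; lia.
by move=> u un; rewrite (sect_abE pf) // mulN1r.
Qed.

Lemma ip_sect n j f h : prim n.+1 j f -> prim n.+1 j h ->
  ip n.+1 f h = ip n (sect f (true, false)) (sect h (true, false))
    + ip n (sect f (false, true)) (sect h (false, true))
    + ip n (sect f (false, false)) (sect h (false, false))
    + ip n (sF (sect f (false, false))) (sF (sect h (false, false))).
Proof.
move=> pf ph; rewrite /= sum_bool_pair; congr (_ + _); first by rewrite -addrA addrC.
rewrite (@eq_ip _ _ (fun u => -1 * sF (sect f (false, false)) u) _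
  (fun u => -1 * sF (sect h (false, false)) u)); last 2 first.
- by move=> u un; rewrite (sect_abE pf) // mulN1r.
- by move=> u un; rewrite (sect_abE ph) // mulN1r.
by rewrite ip_scalel ipC ip_scalel ipC mulrA mulrNN !mul1r.
Qed.

(** The summands of (j + 1) x = low + E F x are orthogonal, and F E = j + 1 on F x turns the product
    of the second summands into one of the F x. *)
Lemma ip_low_low n j f h : prim n.+1 j.+1 f -> prim n.+1 j.+1 h ->
  j.+1%:Z ^+ 2 * ip n (sect f (false, false)) (sect h (false, false)) =
  ip n (low j.+1 f) (low j.+1 h) +
  j.+1%:Z * ip n (sF (sect f (false, false))) (sF (sect h (false, false))).
Proof.
move=> pf ph; have [_ Fh] := prim_low ph.
rewrite (ip_low pf) // [ip n _ (low _ _)]ipC ip_linl ip_adj.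
rewrite [ip n _ (sF (sect f _))]ipC [ip n (sect h _) _]ipC; ring.
Qed.

(* An orthogonal basis mod p of the lattice modulo the radical of c times the form,
   expressed by divisibility over Z; the factor c = j + 1 vanishes mod p when
   j + 1 = p. *)
Definition gram_base (p : nat) (c : int) (n j : nat) (I : finType) (S : I -> cfun) :=
  [/\ forall i, prim n j (S i),
      forall i i', i != i' -> (p %| ip n (S i) (S i'))%Z,
      forall i, ~~ (p %| c * ip n (S i) (S i))%Z &
      forall v, prim n j v -> (forall i, (p %| ip n v (S i))%Z) ->
      forall w, prim n j w -> (p %| c * ip n v w)%Z].

Lemma Euclid_dvdzM (p : nat) (a b : int) : prime p ->
  (p %| a * b)%Z = (p %| a)%Z || (p %| b)%Z.
Proof. by move=> pp; rewrite !dvdzE abszM Euclid_dvdM. Qed.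

Lemma gram_base_scale p c n j (I : finType) (S : I -> cfun) : prime p ->
  ~~ (p %| c)%Z -> gram_base p 1 n j S -> gram_base p c n j S.
Proof.
move=> pp pc [S1 S2 S3 S4]; split=> // [i|v pv vS w pw].
  by rewrite Euclid_dvdzM // negb_or pc; have := S3 i; rewrite mul1r.
by rewrite dvdz_mull // -[ip _ _ _]mul1r S4.
Qed.

(** The embeddings carry over the four families. They keep the form on the first three and multiply
    it by (j + 1)(j + 2) on the last, so the basis of index j + 2 is taken relative to the factor j
    + 2. *)
Lemma gram_baseS p n j (I J K : finType) (S : I -> cfun) (T : J -> cfun) (U : K -> cfun) :
  prime p -> (j.+1 < p)%N ->
  gram_base p 1 n j.+1 S -> gram_base p 1 n j T -> gram_base p j.+2%:Z n j.+2 U ->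
  exists V : (I + I) + (J + K) -> cfun, gram_base p 1 n.+1 j.+1 V.
Proof.
move=> pp jp [S1 S2 S3 S4] [T1 T2 T3 T4] [U1 U2 U3 U4].
have pj : (p %| j.+1%:Z)%Z = false by rewrite dvdzE /= gtnNdvd.
pose V (i : (I + I) + (J + K)) := match i with
  | inl (inl i) => emb_a (S i) | inl (inr i) => emb_b (S i)
  | inr (inl i) => emb_0 (T i) | inr (inr i) => emb_E j.+1 (U i) end.
have VP i : prim n.+1 j.+1 (V i).
  by case: i => [[]|[]] i; [exact: prim_emb_a|exact: prim_emb_b
    |exact: prim_emb_0|exact: prim_emb_E].
have ipVa f i : ip n.+1 f (V (inl (inl i))) = ip n (sect f (true, false)) (S i)
  by exact: ip_emb_a.
have ipVb f i : ip n.+1 f (V (inl (inr i))) = ip n (sect f (false, true)) (S i)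
  by exact: ip_emb_b.
have ipV0 f i : ip n.+1 f (V (inr (inl i))) = ip n (sect f (false, false)) (T i)
  by exact: ip_emb_0.
have ipVE f i : prim n.+1 j.+1 f -> ip n.+1 f (V (inr (inr i))) =
  j.+2%:Z * ip n (sF (sect f (false, false))) (U i) by exact: ip_emb_E.
have FT i s : size s = n -> sF (T i) s = 0 by have [_] := T1 i; apply.
have FEU i s : size s = n -> sF (sE (U i)) s = j.+1%:Z * U i s by move/(sFE_prim (U1 i)).
exists V; split=> //.
- have sym i i' : ip n.+1 (V i) (V i') = ip n.+1 (V i') (V i) by exact: ipC.
  have z i i' : (ip n.+1 (V i) (V i') = 0) -> (p %| ip n.+1 (V i) (V i'))%Z by move=> ->.
  case=> [[]|[]] i [[]|[]] i' ne.
  + by rewrite ipVa S2.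
  + by apply: z; rewrite ipVb ip0l.
  + by apply: z; rewrite ipV0 ip0l.
  + by apply: z; rewrite ipVE // ip0l ?mulr0 // => u _; exact: sF0.
  + by apply: z; rewrite ipVa ip0l.
  + by rewrite ipVb S2.
  + by apply: z; rewrite ipV0 ip0l.
  + by apply: z; rewrite ipVE // ip0l ?mulr0 // => u _; exact: sF0.
  + by apply: z; rewrite ipVa ip0l.
  + by apply: z; rewrite ipVb ip0l.
  + by rewrite ipV0 T2.
  + by apply: z; rewrite ipVE // ip0l ?mulr0 // => u us; exact: FT.
  + by apply: z; rewrite ipVa ip0l.
  + by apply: z; rewrite ipVb ip0l.
  + by apply: z; rewrite sym ipVE // ip0l ?mulr0 // => u us; exact: FT.
  + rewrite ipVE // (@eq_ip _ _ (fun u => j.+1%:Z * U i u) (U i') (U i')) //; last first.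
      by move=> u un; rewrite -FEU.
    by rewrite ip_scalel !dvdz_mull // U2.
- case=> [[]|[]] i; rewrite mul1r.
  + by rewrite ipVa; have := S3 i; rewrite mul1r.
  + by rewrite ipVb; have := S3 i; rewrite mul1r.
  + by rewrite ipV0; have := T3 i; rewrite mul1r.
  + rewrite ipVE // (@eq_ip _ _ (fun u => j.+1%:Z * U i u) (U i) (U i)) //; last first.
      by move=> u un; rewrite -FEU.
    by rewrite ip_scalel mulrCA Euclid_dvdzM // negb_or pj U3.
move=> v pv vV w pw; rewrite mul1r.
have vS1 : (p %| ip n (sect v (true, false)) (sect w (true, false)))%Z.
  rewrite -[ip _ _ _]mul1r S4 //; [exact: prim_sect_a|move=> i|exact: prim_sect_a].
  by rewrite -ipVa.
have vS2 : (p %| ip n (sect v (false, true)) (sect w (false, true)))%Z.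
  rewrite -[ip _ _ _]mul1r S4 //; [exact: prim_sect_b|move=> i|exact: prim_sect_b].
  by rewrite -ipVb.
have vT : (p %| ip n (low j.+1 v) (low j.+1 w))%Z.
  rewrite -[ip _ _ _]mul1r T4 //; [exact: prim_low|move=> i|exact: prim_low].
  by rewrite (ip_low pv) ?dvdz_mull -?ipV0 // => s; exact: FT.
have vU : (p %| j.+2%:Z * ip n (sF (sect v (false, false))) (sF (sect w (false, false))))%Z.
  (* If p does not divide j + 2, this factor cancels from the orthogonality to the last family. *)
  have [pj2|pj2] := boolP (p %| j.+2%:Z)%Z; first exact: dvdz_mulr.
  apply: U4; [exact: prim_sF_sect|move=> i|exact: prim_sF_sect].
  by have := vV (inr (inr i)); rewrite ipVE // Euclid_dvdzM // (negPf pj2).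
(* The p-adic unit (j + 1)^2 clears the denominators in the splitting of x. *)
suff : (p %| j.+1%:Z ^+ 2 * ip n.+1 v w)%Z by rewrite !Euclid_dvdzM // pj.
rewrite (ip_sect pv pw) !mulrDr (ip_low_low pv pw) -!addrA.
(* The products of the F x come once from [ip_low_low] and once from the a b coefficients. *)
have -> (a : int) : j.+1%:Z * a + j.+1%:Z ^+ 2 * a = j.+1%:Z * (j.+2%:Z * a) by lia.
apply: rpredD; first exact: dvdz_mull.
apply: rpredD; first exact: dvdz_mull.
by apply: rpredD => //; exact: dvdz_mull.
Qed.

(** * Walk counts and bases in every genus *)

(** For p > 1 these are the walks of length g between j and 1 with two kinds of stationary step,
    killed at 0 and p: the coefficient of <j> in the g-th power of 2<1> + <2>. *)
Fixpoint walks (p g j : nat) : nat :=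
  if g is g'.+1 then
    if (0 < j < p)%N then (2 * walks p g' j + walks p g' j.-1 + walks p g' j.+1)%N else 0%N
  else (j == 1%N).

Lemma walks_p p g : (1 < p)%N -> walks p g p = 0%N.
Proof. by case: g => [|g] /=; rewrite ?ltnn ?andbF //; case: p => [|[]]. Qed.

Lemma gram_base_void (p : nat) (c : int) n j (S : void -> cfun) :
  (forall v w, prim n j v -> prim n j w -> (p %| c * ip n v w)%Z) -> gram_base p c n j S.
Proof. by move=> h; split=> [[]|[]|[]|v pv _ w pw]; exact: h. Qed.

Lemma gram_base_ex p g j : prime p -> (j < p)%N ->
  exists (I : finType) (S : I -> cfun), #|I| = walks p g j /\ gram_base p 1 g j S.
Proof.
move=> pp; have p1 := prime_gt1 pp.
elim: g j => [|g IH] [|j] jp.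
- exists void, (fun _ _ => 0); split; first by rewrite card_void.
  by apply: gram_base_void => v w /prim0 v0 _; rewrite ip0l // mulr0.
- case: j jp => [|j] jp.
    (* In genus 0 and index 1 the lattice is Z, with generator 1 of norm 1. *)
    exists unit, (fun _ _ => 1); split; first by rewrite card_unit.
    split=> [_|[] [] //|_|v pv vS w pw].
    + by split=> [[]|[]].
    + by rewrite /= !mul1r dvdzE /= dvdn1 gtn_eqF.
    + by have := vS tt; rewrite /= mulr1 mul1r => ?; rewrite dvdz_mulr.
  (* For a larger index in genus 0 the degree would be negative, so the lattice is zero. *)
  exists void, (fun _ _ => 0); split; first by rewrite card_void.
  apply: gram_base_void => v w [hv _] _; rewrite ip0l ?mulr0 // => u /size0nil ->.
  by apply: contraTeq isT => /hv /= /(_ erefl).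
- exists void, (fun _ _ => 0); split; first by rewrite card_void.
  by apply: gram_base_void => v w /prim0 v0 _; rewrite ip0l // mulr0.
have [I [S [cI hS]]] := IH _ jp; have [J [T [cJ hT]]] := IH _ (ltnW jp).
have [K [U [cK hU]]] : exists (K : finType) (U : K -> cfun),
    #|K| = walks p g j.+2 /\ gram_base p j.+2%:Z g j.+2 U.
  move: jp; rewrite leq_eqVlt => /predU1P[jp|jp].
    (* When j + 2 = p the rescaled form vanishes mod p and the empty family works; this is the rule
       <p> = 0. *)
    exists void, (fun _ _ => 0); split; first by rewrite card_void jp walks_p.
    by apply: gram_base_void => v w _ _; rewrite jp dvdz_mulr.
  have [K [U [cK hU]]] := IH _ jp; exists K, U; split=> //.
  by apply: gram_base_scale => //; rewrite dvdzE /= gtnNdvd.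
have [V hV] := gram_baseS pp jp hS hT hU.
exists ((I + I) + (J + K))%type, V; split=> //.
by rewrite !card_sum cI cJ cK /= jp; lia.
Qed.

Lemma sF_sum (f : cfun) s :
  sF f s = \sum_(i < size s) if nth (false, false) s i == (false, false)
    then f (set_nth (false, false) s i (true, true)) else 0.
Proof.
elim: s f => [|c t IH] f /=; first by rewrite big_ord0.
by rewrite big_ord_recl /= IH.
Qed.

Definition code g (S : {set 'I_(g + g)}) : g.-tuple (bool * bool) :=
  [tuple (lshift g i \in S, rshift g i \in S) | i < g].

Definition decode g (t : g.-tuple (bool * bool)) : {set 'I_(g + g)} :=
  [set k | match fintype.split k with inl i => (tnth t i).1 | inr i => (tnth t i).2 end].

Lemma codeK g : cancel (@code g) (@decode g).
Proof.
move=> S; apply/setP => k; rewrite inE.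
by case: split_ordP => i ->; rewrite tnth_mktuple.
Qed.

Lemma decodeK g : cancel (@decode g) (@code g).
Proof.
move=> t; apply: eq_from_tnth => i; rewrite tnth_mktuple !inE.
by rewrite !(unsplitK (inl _)) !(unsplitK (inr _)) -surjective_pairing.
Qed.

Lemma wt_code g (S : {set 'I_(g + g)}) : wt (code S) = #|S|.
Proof.
have E s : wt s = \sum_(c <- s) (c.1 + c.2)%N.
  by elim: s => [|c s IH]; rewrite ?big_nil // big_cons /= IH.
rewrite E big_tuple -sum1_card [RHS]big_mkcond big_split_ord /= -big_split /=.
by apply: eq_bigr => i _; rewrite tnth_mktuple; do 2 case: (_ \in _).
Qed.

Lemma ip_sum g (f h : cfun) :
  ip g f h = \sum_(t : g.-tuple (bool * bool)) f t * h t.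
Proof.
elim: g f h => [|g IH] f h /=.
  by rewrite (big_pred1 [tuple]) // => t; apply/esym/eqP; rewrite [t]tuple0; exact: val_inj.
under eq_bigr do rewrite IH.
rewrite pair_bigA /= (reindex (fun t : g.+1.-tuple (bool * bool) => (thead t, [tuple of behead t]))) /=.
  by apply: eq_bigr => t _; rewrite /sect [in RHS](tuple_eta t).
exists (fun q : (bool * bool) * g.-tuple (bool * bool) => [tuple of q.1 :: q.2]) => [t _|[c t] _] /=.
  by rewrite [RHS]tuple_eta.
by congr (_, _); apply: val_inj.
Qed.

(** * Comparison with the exterior algebra *)

(* The parity of the permutation from a_0, ..., a_(g-1), b_0, ..., b_(g-1) to the
   order a_0, b_0, a_1, b_1, ..., in which multiplication by a_i b_i has no sign. *)
Definition eta g (S : {set 'I_(g + g)}) : nat :=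
  \sum_(k < g) \sum_(l < g) [&& (l < k)%N, lshift g k \in S & rshift g l \in S].

Definition phi g (f : cfun) : ext int (g + g) := [ffun S => (-1) ^+ eta S * f (code S)].

Lemma inner_phi g f h : inner (phi g f) (phi g h) = ip g f h.
Proof.
rewrite ip_sum (reindex (@code g)) /=; last first.
  by exists (@decode g) => ? _; [exact: codeK|exact: decodeK].
by apply: eq_bigr => S _; rewrite !ffunE mulrACA -expr2 sqrr_sign mul1r.
Qed.

(** A section of [phi]; lists of length other than g carry no information and get the value 0. *)
Definition psi g (x : ext int (g + g)) : cfun := fun s =>
  if insub s is Some t then (-1) ^+ eta (decode t) * x (decode (t : g.-tuple _)) else 0.

Lemma psiK g : cancel (@psi g) (@phi g).
Proof.
move=> x; apply/ffunP => S; rewrite ffunE /psi valK codeK.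
by rewrite mulrA -expr2 sqrr_sign mul1r.
Qed.

Section OneHandle.
Context (g : nat) (i : 'I_g).
Let a := lshift g i.
Let b := rshift g i.

Lemma ltn_ab : (a < b)%N.
Proof. by rewrite /=; have := ltn_ord i; lia. Qed.

Lemma inversionsE (S : {set 'I_(g + g)}) (T : {set 'I_(g + g)}) :
  inversions S T = (\sum_(s in S) \sum_(t in T) (t < s)%N)%N.
Proof.
rewrite /inversions -sum1_card pair_big_dep /= big_mkcond [RHS]big_mkcond.
by apply: eq_bigr => -[s t] _ /=; rewrite inE /=; do 2 case: (_ \in _) => //=; case: ltnP.
Qed.

Lemma wedge_ab (K : comNzRingType) :
  wedge (symp_a K i) (symp_b K i) = mono K [set a; b].
Proof.
rewrite wedge_mono ifT; last first.
  by rewrite disjoints1 inE neq_ltn ltn_ab.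
by rewrite inversionsE !big_set1 ltnNge ltnW ?ltn_ab // expr0 scale1r.
Qed.

(** Up to parity both sides count the a_k in S with k > i and the b_l in S with l < i. *)
Lemma inversions_ab (S : {set 'I_(g + g)}) : a \notin S -> b \notin S ->
  odd (inversions S [set a; b]) = odd (eta (S :|: [set a; b])) (+) odd (eta S).
Proof.
move=> aS bS.
pose A k := lshift g k \in S; pose B l := rshift g l \in S.
have Ai : A i = false by exact/negbTE.
have Bi : B i = false by exact/negbTE.
(* Each b_l in S lies beyond a_i, and beyond b_i when i < l: it contributes 1 + (i < l), which is (l
   < i) plus an even number since l is not i. *)
have -> : inversions S [set a; b] =
    (\sum_(k < g | A k) (i < k) + \sum_(l < g | B l) (l < i)
     + (\sum_(l < g | B l) (i < l)).*2)%N.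
  rewrite inversionsE.
  under eq_bigr do rewrite (big_setU1 _ (_ : a \notin [set b])) ?inE ?neq_ltn ?ltn_ab //= big_set1.
  rewrite big_mkcond big_split_ord /= -!big_mkcond -addnA; congr (_ + _)%N.
    apply: eq_bigr => k _; have kg := ltn_ord k.
    by rewrite [X in (_ + X)%N](_ : _ = 0%N) ?addn0 //; case: ltnP => //; lia.
  rewrite -mul2n big_distrr -big_split /=; apply: eq_bigr => l Bl.
  have : l != i by apply: contraTneq Bl => ->; rewrite -/(B i) Bi.
  rewrite -val_eqE ltn_add2l (leq_trans (ltn_ord i) (leq_addr _ _)).
  by rewrite neq_ltn; case: (ltngtP l i).
(* The new b_i pairs with the a_k for k > i and the new a_i with the b_l for l < i; a_i and b_i do
   not pair with each other. *)
have -> : eta (S :|: [set a; b]) =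
    (eta S + (\sum_(k < g | A k) (i < k) + \sum_(l < g | B l) (l < i)))%N.
  have D (F : 'I_g -> nat) : (\sum_(l < g) (l == i) * F l = F i)%N.
    by rewrite (bigD1 i) //= eqxx mul1n big1 ?addn0 // => l /negPf ->.
  rewrite /eta.
  transitivity (\sum_(k < g) \sum_(l < g) ([&& (l < k)%N, A k & B l]
     + ((l == i) * (A k * (l < k)) + (k == i) * (B l * (l < k)))))%N.
    apply: eq_bigr => k _; apply: eq_bigr => l _; rewrite !inE.
    rewrite !(inj_eq (@lshift_inj _ _)) !(inj_eq (@rshift_inj _ _)) eq_lrshift eq_rlshift.
    rewrite orbF -/(A k) -/(B l).
    case: (eqVneq k i) => [->|_]; case: (eqVneq l i) => [->|_];
      rewrite ?Ai ?Bi ?ltnn ?orbF ?orbT ?andbF ?andbT //=.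
    - by case: (B l); case: (l < i)%N.
    - by case: (A k); case: (i < k)%N.
    - by rewrite !mul0n !addn0.
  under eq_bigr do rewrite big_split.
  rewrite big_split; congr (_ + _)%N.
  under eq_bigr do rewrite big_split /= D.
  rewrite big_split /=; congr (_ + _)%N.
    by rewrite [RHS]big_mkcond; apply: eq_bigr => k _; case: (A k); rewrite ?mul1n.
  rewrite exchange_big /= [RHS]big_mkcond /=; apply: eq_bigr => l _.
  rewrite (bigD1 i) //= eqxx mul1n big1 ?addn0 => [|k /negPf ->] //.
  by case: (B l); rewrite ?mul1n.
by rewrite [in RHS]oddD addbAC addbb addFb oddD odd_double addbF.
Qed.

End OneHandle.

Lemma opF_sum (K : comNzRingType) g (x : ext K (g + g)) (S : {set 'I_(g + g)}) :
  opF x S = \sum_(i < g)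
    if [disjoint S & [set lshift g i; rshift g i]]
    then (-1) ^+ inversions S [set lshift g i; rshift g i]
         * x (S :|: [set lshift g i; rshift g i]) else 0.
Proof.
have wedgeD (u v w : ext K (g + g)) : wedge u (v + w) = wedge u v + wedge u w.
  rewrite /wedge -big_split; apply: eq_bigr => U _.
  rewrite -big_split; apply: eq_bigr => T _.
  by rewrite !ffunE mulrDr scalerDl.
have wedge0 (u : ext K (g + g)) : wedge u 0 = 0.
  by rewrite /wedge big1 // => U _; rewrite big1 // => T _; rewrite ffunE mulr0 scale0r.
have wedge_sum u (F : 'I_g -> ext K (g + g)) :
  wedge u (\sum_i F i) = \sum_i wedge u (F i) by rewrite (big_morph (wedge u) (wedgeD u) (wedge0 u)).
rewrite ffunE /opE /omega wedge_sum.
rewrite /inner; under eq_bigr do rewrite sum_ffunE mulr_suml.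
rewrite exchange_big /=; apply: eq_bigr => i _; rewrite wedge_ab wedge_mono.
case: ifP => _; last by rewrite big1 // => T _; rewrite ffunE mul0r.
rewrite (bigD1 (S :|: [set lshift g i; rshift g i])) //= big1 ?addr0 => [|T /negPf TS].
  by rewrite !ffunE eqxx scale_reg mulr1.
by rewrite !ffunE TS scale_reg mulr0 mul0r.
Qed.

(** Both sides are sums over the handles absent from S, and in each term the sign of the wedge
    product is the change of [eta]. *)
Lemma opF_phi g (f : cfun) : opF (phi g f) = phi g (sF f).
Proof.
apply/ffunP => S; rewrite opF_sum ffunE sF_sum size_tuple mulr_sumr; apply: eq_bigr => i _.
have nthE (T : {set 'I_(g + g)}) (k : 'I_g) :
    nth (false, false) (code T) k = (lshift g k \in T, rshift g k \in T).
  by rewrite -tnth_nth tnth_mktuple.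
have -> : [disjoint S & [set lshift g i; rshift g i]] =
    (nth (false, false) (code S) i == (false, false)).
  rewrite nthE disjoint_sym -finset.setI_eq0 finset.setIUl finset.setU_eq0 !finset.setI_eq0 !disjoints1.
  by do 2 case: (_ \in _).
case: eqP => [|_]; last by rewrite mulr0.
rewrite nthE => -[/negbT aS /negbT bS]; rewrite ffunE mulrA; congr (_ * f _); last first.
  apply: (@eq_from_nth _ (false, false)).
    by rewrite size_set_nth !size_tuple; apply/esym/maxn_idPr.
  move=> k; rewrite size_tuple => kg; rewrite nth_set_nth /=.
  rewrite -[k]/(nat_of_ord (Ordinal kg)) !nthE !inE.
  rewrite !(inj_eq (@lshift_inj _ _)) !(inj_eq (@rshift_inj _ _)) eq_lrshift eq_rlshift orbF /=.
  rewrite -val_eqE /=; case: eqVneq => _; by rewrite ?orbT ?orbF.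
have sgnE (m n k : nat) : odd m = odd n (+) odd k -> (-1) ^+ m * (-1) ^+ n = (-1) ^+ k :> int.
  by rewrite -(signr_odd _ m) -(signr_odd _ n) -(signr_odd _ k) => ->; do 2 case: (odd _).
by apply: sgnE; exact: inversions_ab.
Qed.

Lemma phi_neq0 g f (S : {set 'I_(g + g)}) : (phi g f S != 0) = (f (code S) != 0).
Proof. by rewrite ffunE mulf_eq0 signr_eq0. Qed.

Lemma tuple_code g (s : seq (bool * bool)) : size s = g -> exists S : {set 'I_(g + g)}, s = code S.
Proof.
by move=> sg; exists (decode (tcast sg (in_tuple s))); rewrite decodeK val_tcast.
Qed.

Lemma VZ_phi g j f : VZ g j (phi g f) <-> prim g j f.
Proof.
rewrite /VZ opF_phi addn1; split=> [/andP[/forallP h /eqP F0]|[h F0]].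
  split=> s /tuple_code[S ->].
    by have /implyP := h S; rewrite phi_neq0 wt_code => hS /hS /eqP.
  by apply/eqP; apply: contraTT isT; rewrite -phi_neq0 F0 ffunE eqxx.
apply/andP; split.
  apply/forallP => S; apply/implyP; rewrite phi_neq0 -wt_code => /h.
  by rewrite size_tuple => ->.
by apply/eqP/ffunP => S; rewrite [LHS]ffunE F0 ?size_tuple // mulr0 ffunE.
Qed.

(** * Reduction mod p and the rank of the form *)

Lemma inner_red p n (v w : ext int n) : inner (red p v) (red p w) = (inner v w)%:~R.
Proof. by rewrite /inner rmorph_sum; apply: eq_bigr => S _; rewrite !ffunE rmorphM. Qed.

Lemma Fp_int_eq0 (p : nat) (a : int) : prime p -> ((a%:~R : 'F_p) == 0) = (p %| a)%Z.
Proof.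
move=> pp; rewrite dvdzE (dvdn_pcharf (pchar_Fp pp)).
by case: (intP a) => [|n|n]; rewrite ?rmorphN ?oppr_eq0 ?abszN.
Qed.

Lemma inner_linl (K : comNzRingType) n (a : K) (u v w : ext K n) :
  inner (a *: u + v) w = a * inner u w + inner v w.
Proof.
rewrite /inner mulr_sumr -big_split; apply: eq_bigr => S _.
by rewrite !ffunE scale_reg mulrDl mulrA.
Qed.

Lemma inner0l (K : comNzRingType) n (w : ext K n) : inner 0 w = 0.
Proof. by rewrite /inner big1 // => S _; rewrite ffunE mul0r. Qed.

Lemma inner_suml (K : comNzRingType) n m (c : 'I_m -> K) (s : 'I_m -> ext K n) (w : ext K n) :
  inner (\sum_i c i *: s i) w = \sum_i c i * inner (s i) w.
Proof.
rewrite /inner; under eq_bigr do rewrite sum_ffunE mulr_suml.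
rewrite exchange_big; apply: eq_bigr => i _; rewrite mulr_sumr.
by apply: eq_bigr => S _; rewrite ffunE scale_reg mulrA.
Qed.

(** The reductions of the [S i] are orthogonal of nonzero norm, hence independent, and vectors
    orthogonal to all of them lie in the radical; so they span a complement of [null_Vp] in [Vp]. *)
Lemma dim_Vbar_gram_base p g j (I : finType) (S : I -> cfun) : prime p ->
  gram_base p 1 g j S -> dim_Vbar p g j = #|I|.
Proof.
move=> pp [S1 S2 S3 S4].
pose s i := red p (phi g (S i)).
have sV i : s i \in Vp p g j.
  by apply/mem_Vp; exists (phi g (S i)) => //; apply/VZ_phi.
have ss i i' : i != i' -> inner (s i) (s i') = 0.
  by move=> ii; apply/eqP; rewrite inner_red inner_phi Fp_int_eq0 // S2.
have sn i : inner (s i) (s i) != 0.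
  by rewrite inner_red inner_phi Fp_int_eq0 //; have := S3 i; rewrite mul1r.
have sN v : v \in Vp p g j -> (forall i, inner v (s i) = 0) -> v \in null_Vp p g j.
  move=> vV vs; apply/mem_null_Vp; split=> // w.
  move: vV vs => /mem_Vp[v' + ->] vs /mem_Vp[w' + ->].
  rewrite -(psiK v') -(psiK w') => /VZ_phi pv /VZ_phi pw.
  apply/eqP; rewrite inner_red inner_phi Fp_int_eq0 // -[ip _ _ _]mul1r S4 // => i.
  by rewrite -Fp_int_eq0 // -inner_phi -inner_red psiK vs.
pose X := [tuple s (enum_val i) | i < #|I|].
have XE (i : 'I_#|I|) : X`_i = s (enum_val i) by rewrite -tnth_nth tnth_mktuple.
have inner_sum (c : 'I_#|I| -> 'F_p) (k : 'I_#|I|) :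
    inner (\sum_i c i *: X`_i) X`_k = c k * inner X`_k X`_k.
  rewrite (inner_suml c (fun i => X`_i)) (bigD1 k) //= big1 ?addr0 // => i ik.
  by rewrite !XE ss ?mulr0 // (inj_eq enum_val_inj).
have Xfree : free X.
  apply/freeP => c c0 i; apply/eqP; have /eqP := inner_sum c i.
  by rewrite c0 inner0l XE eq_sym mulf_eq0 (negPf (sn _)) orbF.
have NV : (null_Vp p g j <= Vp p g j)%VS by apply/subvP => v /mem_null_Vp[].
have XV : (<<X>> <= Vp p g j)%VS by apply/span_subvP => _ /tnthP[i ->]; rewrite tnth_mktuple.
have V_sum : Vp p g j = (<<X>> + null_Vp p g j)%VS.
  apply/eqP; rewrite eqEsubv subv_add XV NV !andbT; apply/subvP => v vV.
  (* Subtracting the orthogonal projection onto the span of [X] leaves a vector of the radical. *)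
  pose c (i : 'I_#|I|) := inner v X`_i / inner X`_i X`_i.
  have XX : \sum_i c i *: X`_i \in <<X>>%VS.
    by apply: memv_suml => i _; rewrite memvZ // memv_span // mem_nth // size_tuple.
  rewrite -[v](subrK (\sum_i c i *: X`_i)) addrC memv_add //; apply: sN => [|i].
    by rewrite memvB // (subvP XV).
  have := inner_sum c (enum_rank i); rewrite XE enum_rankK => ci.
  rewrite addrC -scaleN1r inner_linl ci /c XE enum_rankK divfK ?sn //.
  by rewrite mulN1r addNr.
have XN : (<<X>> :&: null_Vp p g j = 0)%VS.
  apply/eqP; rewrite -subv0; apply/subvP => v /memv_capP[vX /mem_null_Vp[_ vN]].
  rewrite memv0 (coord_span vX) big1 // => k _.
  have /eqP : inner v X`_k = 0 by rewrite vN // XE.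
  rewrite {1}(coord_span vX) (inner_sum (fun i => coord X i v)) XE mulf_eq0 (negPf (sn _)) orbF.
  by move=> /eqP ->; rewrite scale0r.
rewrite /dim_Vbar V_sum dimv_disjoint_sum // addnK.
by move: Xfree => /eqnP ->; rewrite size_tuple.
Qed.

Lemma dim_Vbar_walks p g j : prime p -> (j < p)%N -> dim_Vbar p g j = walks p g j.
Proof.
move=> pp jp; have [I [S [cI hS]]] := gram_base_ex g pp jp.
by rewrite (dim_Vbar_gram_base pp hS).
Qed.

(** * Trigonometric sums and growth *)

(* <k> as a polynomial in f = 2 + <2>. *)
Fixpoint cheb (k : nat) : {poly int} :=
  match k with
  | 0 => 0
  | k'.+1 => match k' with
             | 0 => 1
             | k''.+1 => ('X - 2%:P) * cheb k' - cheb k''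
             end
  end.

Lemma chebSS k : cheb k.+2 = ('X - 2%:P) * cheb k.+1 - cheb k.
Proof. by []. Qed.

Lemma size_cheb k : size (cheb k) = k /\ cheb k.+1 \is monic.
Proof.
suff [//] : (size (cheb k) = k /\ cheb k.+1 \is monic) /\ size (cheb k.+1) = k.+1.
elim: k => [|k [[IH0 IHm] IH1]]; first by rewrite size_poly0 size_poly1 monic1.
have sz : size (('X - 2%:P) * cheb k.+1) = k.+2
  by rewrite size_monicM ?monicXsubC ?monic_neq0 // size_XsubC IH1.
have lt : (size (- cheb k)%R < size (('X - 2%:P) * cheb k.+1)%R)%N by rewrite size_polyN sz IH0 ltnW.
rewrite IH1 chebSS size_polyDl // sz; split=> //; split=> //.
by rewrite monicE lead_coefDl // -monicE monicMl // monicXsubC.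
Qed.

Lemma coef_cheb k n : (k <= n.+1)%N -> (cheb k)`_n = (k == n.+1)%:R.
Proof.
have [->|/negPf kn] := eqVneq k n.+1.
  by have [_] := size_cheb n; rewrite monicE /lead_coef (size_cheb n.+1).1 => /eqP.
by move=> ?; rewrite nth_default // (size_cheb k).1; lia.
Qed.

Lemma horner_chebSS (R : comNzRingType) k (x : R) :
  (map_poly intr (cheb k.+2)).[x] =
  (x - 2) * (map_poly intr (cheb k.+1)).[x] - (map_poly intr (cheb k)).[x].
Proof. by rewrite chebSS rmorphB rmorphM rmorphB /= map_polyX map_polyC !hornerE. Qed.

Section Growth.
Context (R : realType).

(** After division by lam^g only the terms with mu = lam survive, and i0 makes the sum of their
    coefficients positive. Where c vanishes, mu is unrestricted. *)
Lemma grows_as_sum (I : finType) (c mu : I -> R) (lam : R) (i0 : I) : 0 < lam ->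
  (forall i, [\/ c i = 0, `|mu i| < lam | mu i = lam /\ 0 <= c i]) ->
  mu i0 = lam -> 0 < c i0 ->
  grows_as (fun g => \sum_i c i * mu i ^+ g) lam.
Proof.
move=> lam0 h mu0 c0.
exists (\sum_(i | mu i == lam) c i).
  rewrite (bigD1 i0) /=; last exact/eqP.
  rewrite ltr_pwDl // sumr_ge0 // => i /andP[/eqP e _].
  by case: (h i) => [->//||[]//]; rewrite e gtr0_norm // ltxx.
rewrite [X in (_ --> X)%classic]big_mkcond /=.
under eq_fun do rewrite mulr_suml.
apply: cvg_big => [|i _]; first exact: add_continuous.
rewrite (_ : (fun g => _) = (fun g => c i * (mu i / lam) ^+ g)); last first.
  by apply/funext => g; rewrite expr_div_n mulrA.
case: (h i) => [->|lt|[-> _]].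
- rewrite if_same; under eq_fun do rewrite mul0r; exact: cvg_cst.
- rewrite ifN; last by apply: contraTneq lt => ->; rewrite gtr0_norm // ltxx.
  rewrite -(mulr0 (c i)); apply: cvgMr; apply: cvg_expr.
  by rewrite normrM normfV (gtr0_norm lam0) ltr_pdivrMr // mul1r.
- rewrite eqxx divff ?gt_eqF //; under eq_fun do rewrite expr1n mulr1; exact: cvg_cst.
Qed.

Lemma eq_grows_as (u v : nat -> R) lam : u =1 v -> grows_as v lam -> grows_as u lam.
Proof. by move=> /funext ->. Qed.

Lemma sinM_pi n : sin (n%:R * pi) = 0 :> R.
Proof.
elim: n => [|n IH]; first by rewrite mul0r sin0.
by rewrite -natr1 mulrDl mul1r sinD IH sinpi mul0r mulr0 addr0.
Qed.

Lemma cosM_pi n : cos (n%:R * pi) = (-1) ^+ n :> R.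
Proof.
elim: n => [|n IH]; first by rewrite mul0r cos0.
by rewrite -natr1 mulrDl mul1r cosD IH cospi sinpi mulr0 subr0 exprSr.
Qed.

(** Telescoping, from 2 sin y cos(2 m y) = sin((2 m + 1) y) - sin((2 m - 1) y). *)
Lemma sum_cos_even (y : R) n :
  2 * sin y * \sum_(m < n) cos (m%:R * (2 * y)) = sin (n%:R * (2 * y) - y) + sin y.
Proof.
elim: n => [|n IH]; first by rewrite big_ord0 mulr0 mul0r sub0r sinN addNr.
rewrite big_ord_recr mulrDr IH /=.
rewrite (_ : n.+1%:R * (2 * y) - y = n%:R * (2 * y) + y); last by rewrite -natr1; ring.
by rewrite sinB sinD; ring.
Qed.

Lemma sum_cos_odd (y : R) n :
  2 * sin y * \sum_(i < n) cos ((2 * i + 1)%:R * y) = sin ((2 * n)%:R * y).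
Proof.
elim: n => [|n IH]; first by rewrite big_ord0 mulr0 muln0 mul0r sin0.
rewrite big_ord_recr mulrDr IH /=.
rewrite (_ : (2 * n.+1)%:R * y = (2 * n + 1)%:R * y + y); last by rewrite mulnS; ring.
rewrite (_ : (2 * n)%:R * y = (2 * n + 1)%:R * y - y); last by ring.
by rewrite sinB sinD; ring.
Qed.

Context (p : nat) (p_ge3 : (3 <= p)%N) (p_odd : odd p).
Let t : R := pi / p%:R.

Lemma p_gt0 : 0 < p%:R :> R. Proof. by rewrite ltr0n (leq_trans _ p_ge3). Qed.

Lemma ptE : p%:R * t = pi. Proof. by rewrite mulrC divfK // gt_eqF // p_gt0. Qed.

Lemma t_gt0 : 0 < t. Proof. by rewrite divr_gt0 ?pi_gt0 // p_gt0. Qed.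

Lemma lt_tpi m : (m < p)%N -> m%:R * t < pi.
Proof. by move=> mp; rewrite -ptE ltr_pM2r ?t_gt0 // ltr_nat. Qed.

Lemma sin_gt0 m : (0 < m < p)%N -> 0 < sin (m%:R * t).
Proof.
move=> /andP[m0 mp]; apply: sin_gt0_pi; rewrite lt_tpi // andbT.
by rewrite mulr_gt0 ?t_gt0 // ltr0n.
Qed.

Lemma sin_lt0 m : (p < m < 2 * p)%N -> sin (m%:R * t) < 0.
Proof.
move=> /andP[pm mp].
have -> : m%:R * t = (m - p)%:R * t + pi by rewrite natrB 1?ltnW// mulrBl ptE subrK.
by rewrite sinDpi oppr_lt0 sin_gt0 //; lia.
Qed.

Lemma sin_half_neq0 k : (0 < k < 2 * p)%N -> sin (k%:R * (t / 2)) != 0.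
Proof.
move=> /andP[k0 kp]; rewrite gt_eqF //; apply: sin_gt0_pi; apply/andP; split.
  by rewrite mulr_gt0 ?ltr0n // divr_gt0 ?t_gt0.
rewrite -ptE (_ : _ * (t / 2) = k%:R / 2 * t); last by ring.
by rewrite ltr_pM2r ?t_gt0 // ltr_pdivrMr // -natrM ltr_nat mulnC.
Qed.

Lemma sum_cos k : (0 < k < 2 * p)%N ->
  \sum_(m < p) cos (m%:R * (k%:R * t)) = (1 - (-1) ^+ k) / 2.
Proof.
move=> kp; have s0 := sin_half_neq0 kp.
have := sum_cos_even (k%:R * (t / 2)) p.
have -> : 2 * (k%:R * (t / 2)) = k%:R * t by field.
have -> : p%:R * (k%:R * t) = k%:R * pi by rewrite -ptE; ring.
rewrite sinB sinM_pi cosM_pi mul0r sub0r => e.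
have n2 : 2 != 0 :> R by rewrite pnatr_eq0.
by apply: (mulfI s0); apply: (mulfI n2); rewrite mulrA e; field.
Qed.

(** For i > 0, product-to-sum leaves the cosine sums at i - 1 and i + 1; they agree by parity,
    except that i = 1 gives p and 0. *)
Lemma sin_orth i : (i <= p)%N ->
  \sum_(m < p) sin (m%:R * t) * sin (i%:R * (m%:R * t)) = (p%:R / 2) * (i == 1)%:R.
Proof.
case: i => [_|i ip].
  by rewrite mulr0 big1 // => m _; rewrite mul0r sin0 mulr0.
have E (m : 'I_p) : sin (m%:R * t) * sin (i.+1%:R * (m%:R * t)) =
    2^-1 * (cos (m%:R * (i%:R * t)) - cos (m%:R * (i.+2%:R * t))).
  have -> : m%:R * (i%:R * t) = i.+1%:R * (m%:R * t) - m%:R * t by rewrite -natr1; ring.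
  have -> : m%:R * (i.+2%:R * t) = i.+1%:R * (m%:R * t) + m%:R * t.
    by rewrite -(natr1 i.+1); ring.
  by rewrite cosB cosD; field.
under eq_bigr do rewrite E.
rewrite -mulr_sumr big_split /= sumrN (@sum_cos i.+2); last by lia.
case: i ip {E} => [|i] ip.
  rewrite (eq_bigr (fun=> 1)) => [|m _]; last by rewrite mul0r mulr0 cos0.
  by rewrite sumr_const card_ord /=; field.
by rewrite sum_cos ?mulr0; [rewrite !exprS; field|lia].
Qed.

Lemma sinM_p m : sin (p%:R * (m%:R * t)) = 0.
Proof. by rewrite mulrCA ptE sinM_pi. Qed.

(** As functions of j, the sines vanish at the walls 0 and p and are eigenfunctions of the step
    operator with eigenvalue 2 + 2 cos(m t); orthogonality settles g = 0. *)
Lemma walksE g j : (j <= p)%N ->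
  (walks p g j)%:R = \sum_(m < p) 2 / p%:R * (sin (m%:R * t) * sin (j%:R * (m%:R * t)))
                    * (2 + 2 * cos (m%:R * t)) ^+ g.
Proof.
elim: g j => [|g IH] j jp /=.
  under eq_bigr do rewrite expr0 mulr1.
  by rewrite -mulr_sumr sin_orth //; field; rewrite gt_eqF ?p_gt0.
case: ifP => [/andP[j0 jp']|j0p]; last first.
  rewrite big1 // => m _; suff -> : sin (j%:R * (m%:R * t)) = 0 by rewrite !mulr0 mul0r.
  have [->|->] : j = 0%N \/ j = p by lia.
    by rewrite mul0r sin0.
  exact: sinM_p.
rewrite natrD natrD natrM !IH //; last by lia.
rewrite mulr_sumr -!big_split /=; apply: eq_bigr => m _.
case: j j0 {jp IH} jp' => // j _ _ /=; rewrite exprS -[j.+2%:R]natr1.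
rewrite [(j.+1%:R + 1) * _]mulrDl mul1r sinD.
have -> : j%:R * (m%:R * t) = j.+1%:R * (m%:R * t) - m%:R * t by rewrite -natr1; ring.
by rewrite sinB; ring.
Qed.

Lemma normfE : normf R p = 2 + 2 * cos t.
Proof.
have -> : t = (pi / (2 * p%:R)) *+ 2.
  by rewrite /t mulr2n; field; rewrite gt_eqF // p_gt0.
by rewrite cos_mulr2n /normf mulr2n; ring.
Qed.

Lemma dim_Vbar_grows j : prime p -> (0 < j < p)%N ->
  grows_as (fun g => (dim_Vbar p g j)%:R : R) (normf R p).
Proof.
move=> pp /andP[j0 jp].
apply: (@eq_grows_as _ (fun g => \sum_(m < p) 2 / p%:R *
    (sin (m%:R * t) * sin (j%:R * (m%:R * t))) * (2 + 2 * cos (m%:R * t)) ^+ g)).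
  by move=> g; rewrite dim_Vbar_walks // walksE // ltnW.
have p1 : (1 < p)%N by lia.
have cpos : 0 < cos t - -1.
  rewrite -cospi subr_gt0 ltr_cos ?in_itv /= ?pi_ge0 ?lexx ?(ltW t_gt0) //=.
    by have := lt_tpi p1; rewrite mul1r.
  by have := lt_tpi p1; rewrite mul1r => /ltW.
have cp : 0 < 2 / p%:R * (sin t * sin (j%:R * t)).
  have := @sin_gt0 1 p1; rewrite mul1r => s1.
  by rewrite !mulr_gt0 ?invr_gt0 ?p_gt0 ?sin_gt0 // j0.
rewrite normfE; apply: (@grows_as_sum _ _ _ _ (Ordinal p1)); rewrite /= ?mul1r //.
  by lra.
case=> [[|[|m]] mp] /=.
(* The eigenvalue 4 at m = 0 is larger, but its coefficient contains sin 0 = 0. *)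
- by constructor 1; rewrite mul0r sin0 mul0r mulr0.
- by constructor 3; rewrite mul1r ltW.
constructor 2; rewrite ger0_norm; last by have := cos_geN1 (m.+2%:R * t); lra.
have mt : m.+2%:R * t \in `[0, pi]%R.
  by rewrite in_itv /= mulr_ge0 ?(ltW t_gt0) //= ltW // lt_tpi.
have t1 : t \in `[0, pi]%R.
  by rewrite in_itv /= (ltW t_gt0) /=; have := lt_tpi p1; rewrite mul1r => /ltW.
by rewrite ltrD2l ltr_pM2l // ltr_cos // -[X in X < _]mul1r ltr_pM2r ?t_gt0 // ltr1n.
Qed.

(** * Characters of the fusion ring and the Verlinde sum *)

Let h := (p - 3)./2.

Lemma p_half : p = (2 * h.+1).+1.
Proof. by rewrite /h; lia. Qed.

Lemma p_halfR : p%:R = 2 * h.+1%:R + 1 :> R.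
Proof. by rewrite [in LHS]p_half -natr1 natrM. Qed.

(** Squares of sines become cosines at odd multiples of 2 x. Their telescoped sum ends at the angle
    (p - 1) 2 x, which is - 2 x modulo 2 pi, so it equals - 1/2. *)
Lemma sum_sin_odd m : (0 < m < p)%N ->
  \sum_(0 <= i < h.+1) sin ((2 * i + 1)%:R * (m%:R * t)) ^+ 2 = p%:R / 4.
Proof.
move=> mp; pose x := m%:R * t.
have s2 : sin (2 * x) != 0.
  (* As p is odd, 2 m differs from p; the sine is positive below p and negative above. *)
  rewrite /x mulrA -natrM; have [m2|m2] := ltnP (2 * m) p.
    by rewrite gt_eqF // sin_gt0 // m2 andbT; lia.
  by rewrite lt_eqF // sin_lt0 //; lia.
have C : \sum_(i < h.+1) cos ((2 * i + 1)%:R * (2 * x)) = - 2^-1.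
  have := sum_cos_odd (2 * x) h.+1.
  have -> : (2 * h.+1)%:R * (2 * x) = (2 * m)%:R * pi - 2 * x.
    by rewrite -ptE !natrM p_halfR /x; ring.
  rewrite sinB sinM_pi cosM_pi mul0r sub0r exprM sqrrN !expr1n mul1r => e.
  have n2 : 2 != 0 :> R by rewrite pnatr_eq0.
  by apply: (mulfI s2); apply: (mulfI n2); rewrite mulrA e; field.
have E i : sin ((2 * i + 1)%:R * x) ^+ 2 = 2^-1 - 2^-1 * cos ((2 * i + 1)%:R * (2 * x)).
  have -> : (2 * i + 1)%:R * (2 * x) = ((2 * i + 1)%:R * x) *+ 2 by rewrite mulr2n; ring.
  by rewrite cos_mulr2n cos2sin2 mulr2n; field.
rewrite big_mkord; under eq_bigr do rewrite E.
rewrite big_split /= sumrN -mulr_sumr C sumr_const card_ord p_halfR -[2^-1 *+ _]mulr_natr.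
by field.
Qed.

(* A common eigenvector of multiplication by the elements of the fusion ring. *)
Definition sinv (m : nat) : 'cV[R]_(p.-1) := \col_i sin (i.+1%:R * (m%:R * t)).

(** The character <k> -> sin(k m t) / sin(m t), extended linearly; where sin(m t) = 0, division by
    zero makes it 0. *)
Definition chi (m : nat) (x : fusion p) : R :=
  (\sum_(k < p.-1) (x 0 k)%:~R * sin (k.+1%:R * (m%:R * t))) / sin (m%:R * t).

Local Notation "A ^R" := (map_mx (intr : int -> R) A) (at level 2).

Lemma fus_two_sinv m : (fus_two p)^R *m sinv m = (2 * cos (m%:R * t)) *: sinv m.
Proof.
apply/colP => i; rewrite !mxE.
have -> : 2 * cos (m%:R * t) * sin (i.+1%:R * (m%:R * t)) =
    sin (i%:R * (m%:R * t)) + sin (i.+2%:R * (m%:R * t)).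
  rewrite (_ : i%:R * _ = i.+1%:R * (m%:R * t) - m%:R * t); last by rewrite -natr1; ring.
  rewrite (_ : i.+2%:R * _ = i.+1%:R * (m%:R * t) + m%:R * t); last by rewrite -(natr1 i.+1); ring.
  by rewrite sinB sinD; ring.
under eq_bigr do rewrite !mxE rmorphD !rmorph_nat mulrDl.
rewrite big_split /=; congr (_ + _).
  case: i => -[|i] ip /=.
    by rewrite mul0r sin0 big1 // => j _; rewrite mul0r.
  rewrite (bigD1 (Ordinal (ltnW ip))) //= eqxx mul1r big1 ?addr0 // => j.
  by rewrite -val_eqE /= eqSS => /negPf ->; rewrite mul0r.
have [ip|ip] := ltnP i.+1 p.-1.
  rewrite (bigD1 (Ordinal ip)) //= eqxx mul1r big1 ?addr0 // => j.
  by rewrite -val_eqE /= => /negPf ->; rewrite mul0r.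
(* In the last row the missing neighbour <p> corresponds to sin(p m t) = 0. *)
have -> : i.+2 = p by have := ltn_ord i; lia.
rewrite sinM_p big1 // => j _; case: eqP => [ji|_]; last by rewrite mul0r.
by have := ltn_ord j; rewrite ji ltnNge ip.
Qed.

Lemma fus_op_sinv m k : sin (m%:R * t) != 0 ->
  (fus_op p k)^R *m sinv m = (sin (k%:R * (m%:R * t)) / sin (m%:R * t)) *: sinv m.
Proof.
move=> s0.
suff: (fus_op p k)^R *m sinv m = (sin (k%:R * (m%:R * t)) / sin (m%:R * t)) *: sinv m /\
  (fus_op p k.+1)^R *m sinv m = (sin (k.+1%:R * (m%:R * t)) / sin (m%:R * t)) *: sinv m by case.
elim: k => [|k [IH1 IH2]].
  split; first by rewrite map_mx0 mul0mx mul0r sin0 mul0r scale0r.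
  by rewrite map_mx1 mul1mx mul1r divff // scale1r.
split=> //; rewrite fus_opS map_mxB map_mxM mulmxBl -mulmxA fus_two_sinv -scalemxAr IH1 IH2.
rewrite scalerA -scalerBl; congr (_ *: _).
rewrite (_ : k%:R * _ = k.+1%:R * (m%:R * t) - m%:R * t); last by rewrite -natr1; ring.
rewrite (_ : k.+2%:R * _ = k.+1%:R * (m%:R * t) + m%:R * t); last by rewrite -(natr1 k.+1); ring.
by rewrite sinB sinD; field.
Qed.

Lemma fus_rho_sinv m x : sin (m%:R * t) != 0 -> (fus_rho x)^R *m sinv m = chi m x *: sinv m.
Proof.
move=> s0; rewrite /fus_rho /chi map_mx_sum mulmx_suml mulr_suml scaler_suml.
apply: eq_bigr => k _.
by rewrite map_mxZ -scalemxAl fus_op_sinv // scalerA mulrA.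
Qed.

Lemma chi_sinv m (x : fusion p) : chi m x = (((x : 'rV_(p.-1))^R *m sinv m) 0 0) / sin (m%:R * t).
Proof. by rewrite mxE; congr (_ / _); apply: eq_bigr => k _; rewrite !mxE. Qed.

Lemma chiM m (x y : fusion p) : sin (m%:R * t) != 0 -> chi m (x * y) = chi m x * chi m y.
Proof.
move=> s0; rewrite [LHS]chi_sinv -[x * y]/(y *m fus_rho x) map_mxM -mulmxA fus_rho_sinv //.
by rewrite -scalemxAr mxE -mulrA -chi_sinv.
Qed.

Lemma chi_fus m k : (0 < k < p)%N -> chi m (fus p k) = sin (k%:R * (m%:R * t)) / sin (m%:R * t).
Proof.
case: k => // k kp; have kp1 : (k < p.-1)%N by lia.
rewrite /chi (bigD1 (Ordinal kp1)) //= mxE eqxx mul1r big1 ?addr0 // => i.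
by rewrite -val_eqE mxE eqSS /= => /negPf ->; rewrite mul0r.
Qed.

Lemma chi_sum m (I : Type) (r : seq I) (F : I -> fusion p) :
  chi m (\sum_(i <- r) F i) = \sum_(i <- r) chi m (F i).
Proof.
apply: (big_morph (chi m)) => [x y|]; rewrite /chi.
  by rewrite -mulrDl -big_split; congr (_ / _); apply: eq_bigr => k _; rewrite mxE rmorphD mulrDl.
by rewrite big1 ?mul0r // => k _; rewrite mxE mul0r.
Qed.

Lemma chi_F m : (0 < m < p)%N -> chi m (fus_F p) = p%:R / (4 * sin (m%:R * t) ^+ 2).
Proof.
move=> mp; have s0 : sin (m%:R * t) != 0 by rewrite gt_eqF // sin_gt0.
rewrite chi_sum (eq_big_nat _ _
  (F2 := fun i => sin ((2 * i + 1)%:R * (m%:R * t)) ^+ 2 * (sin (m%:R * t) ^+ 2)^-1)).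
  by rewrite -mulr_suml sum_sin_odd //; field.
move=> i /andP[_ ih]; rewrite expr2 chiM // chi_fus -?expr2 ?expr_div_n //.
by have := p_half; rewrite /h in ih *; lia.
Qed.

Lemma chi_X m (x : fusion p) g : sin (m%:R * t) != 0 -> chi m (x ^+ g) = chi m x ^+ g.
Proof.
move=> s0; elim: g => [|g IH]; last by rewrite !exprS chiM // IH.
by rewrite !expr0 -fus_unit chi_fus ?mul1r ?divff //; lia.
Qed.

(** Fourier inversion: orthogonality of the sines isolates the coordinate of <1>. *)
Lemma fus_coef_chi (x : fusion p) :
  (fus_coef 1 x)%:~R = \sum_(m < p) 2 / p%:R * sin (m%:R * t) ^+ 2 * chi m x.
Proof.
have p1 : (0 < p.-1)%N by lia.
transitivity (\sum_(k < p.-1) (x 0 k)%:~R * (k.+1 == 1)%:R : R).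
  rewrite /fus_coef big_mkcond rmorph_sum; apply: eq_bigr => k _ /=.
  by case: eqP => _; rewrite ?mulr1 ?mulr0.
transitivity (\sum_(k < p.-1) \sum_(m < p) (2 / p%:R) *
   ((x 0 k)%:~R * (sin (m%:R * t) * sin (k.+1%:R * (m%:R * t))))).
  apply: eq_bigr => k _; rewrite -!mulr_sumr sin_orth; last by have := ltn_ord k; lia.
  by field; rewrite gt_eqF ?p_gt0.
rewrite exchange_big; apply: eq_bigr => m _; rewrite /chi.
have [->|s0] := eqVneq (sin (m%:R * t)) 0.
  rewrite invr0 !mulr0 big1 // => k _; by rewrite mul0r !mulr0.
rewrite -mulr_sumr -[RHS]mulrA; congr (_ * _).
have e (y : R) : sin (m%:R * t) ^+ 2 * (y / sin (m%:R * t)) = sin (m%:R * t) * y by field.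
by rewrite e mulr_sumr; apply: eq_bigr => k _; ring.
Qed.

Lemma sin_lt m : (1 < m < p.-1)%N -> sin t < sin (m%:R * t).
Proof.
move=> mp; rewrite -subr_gt0.
(* With these half angles sin(m t) - sin t = 2 cos a sin b, and 1 < m < p - 1 puts both in (0,
   pi/2). *)
pose a := (m.+1%:R / 2) * t; pose b := (m.-1%:R / 2) * t.
have E : m%:R = m.-1%:R + 1 :> R by rewrite natr1; congr (_%:R); lia.
have -> : t = a - b by rewrite /a /b -natr1 E; field.
have -> : m%:R * (a - b) = a + b by rewrite /a /b -natr1 E; field.
rewrite sinB sinD (_ : _ - _ = 2 * (cos a * sin b)); last by ring.
have P2 : pi / 2 = p%:R / 2 * t by rewrite -ptE; ring.
have hb : 0 < b < pi / 2.
  rewrite P2 /b ltr_pM2r ?t_gt0 // ltr_pM2r ?invr_gt0 // ltr_nat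
    mulr_gt0 ?t_gt0 //= ?divr_gt0 ?ltr0n //; lia.
have ha : 0 < a < pi / 2.
  rewrite P2 /a ltr_pM2r ?t_gt0 // ltr_pM2r ?invr_gt0 // ltr_nat
    mulr_gt0 ?t_gt0 //= ?divr_gt0 ?ltr0n //; lia.
rewrite !mulr_gt0 // ?sin_gt0_pihalf // cos_gt0_pihalf //.
by have := pi_gt0 R; move: ha => /andP[a0 ->]; lra.
Qed.

Lemma dim_VI_grows : grows_as (fun g => (dim_VI p g)%:~R : R) (normF R p).
Proof.
apply: (@eq_grows_as _ (fun g => \sum_(m < p) 2 / p%:R * sin (m%:R * t) ^+ 2
    * (p%:R / (4 * sin (m%:R * t) ^+ 2)) ^+ g)).
  move=> g; rewrite /dim_VI fus_coef_chi; apply: eq_bigr => -[[|m] mp] _ /=.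
    by rewrite mul0r sin0 expr0n /= mulr0 !mul0r.
  by rewrite chi_X ?gt_eqF ?sin_gt0 // chi_F.
have p1 : (1 < p)%N by lia.
have s1 : 0 < sin t by have := @sin_gt0 1 p1; rewrite mul1r.
have F0 : 0 < normF R p by rewrite divr_gt0 ?p_gt0 // mulr_gt0 // exprn_gt0.
have c0 x : 0 < x -> 0 < 2 / p%:R * x ^+ 2 :> R.
  by move=> x0; rewrite !mulr_gt0 ?invr_gt0 ?p_gt0.
apply: (@grows_as_sum _ _ _ _ (Ordinal p1)); rewrite /= ?mul1r ?c0 //.
case=> m mp /=; have [->|m0] := posnP m.
  by constructor 1; rewrite mul0r sin0 expr0n mulr0.
have sm : 0 < sin (m%:R * t) by rewrite sin_gt0 // m0.
have [mid|] := boolP (1 < m < p.-1)%N.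
  constructor 2; rewrite ger0_norm; last by rewrite divr_ge0 ?ltW ?p_gt0 // mulr_gt0 // exprn_gt0.
  rewrite /normF ltr_pM2l ?p_gt0 // ltf_pV2 ?posrE ?mulr_gt0 ?exprn_gt0 //.
  by rewrite ltr_pM2l // ltr_pXn2r ?nnegrE ?(ltW sm) ?(ltW s1) // sin_lt.
(* The remaining m = 1 and m = p - 1 both attain the maximum. *)
move=> edge; constructor 3; split; last by rewrite ltW ?c0.
suff -> : sin (m%:R * t) = sin t by [].
have [->|->] : m = 1%N \/ m = p.-1 by lia.
  by rewrite mul1r.
have -> : p.-1%:R * t = pi - t by rewrite -subn1 natrB 1?ltnW // mulrBl ptE mul1r.
by rewrite sinB sinpi cospi; ring.
Qed.

(** * The polynomial relating the two growth rates *)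

Lemma cheb_cos k : (map_poly intr (cheb k)).[2 + 2 * cos t] * sin t = sin (k%:R * t).
Proof.
suff [//] : (map_poly intr (cheb k)).[2 + 2 * cos t] * sin t = sin (k%:R * t) /\
  (map_poly intr (cheb k.+1)).[2 + 2 * cos t] * sin t = sin (k.+1%:R * t).
elim: k => [|k [IH1 IH2]].
  by rewrite rmorph0 rmorph1 !hornerE ?(mul0r, mul1r) sin0.
split=> //; rewrite horner_chebSS mulrDl mulNr -mulrA IH1 IH2.
rewrite (_ : k%:R * _ = k.+1%:R * t - t); last by rewrite -natr1; ring.
rewrite (_ : k.+2%:R * _ = k.+1%:R * t + t); last by rewrite -(natr1 k.+1); ring.
by rewrite sinB sinD; ring.
Qed.

(** This is <k>^2 = <1> + <3> + ... + <2k-1> at m = 1, times sin^2 t, summed over k from 1 to n: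
    <2i+1> occurs n - i times. *)
Lemma sum_sin_weighted n :
  \sum_(i < n) (n - i)%:R * sin ((2 * i + 1)%:R * t) * sin t =
  \sum_(i < n) sin (i.+1%:R * t) ^+ 2.
Proof.
have odd_sum k : \sum_(i < k) sin ((2 * i + 1)%:R * t) * sin t = sin (k%:R * t) ^+ 2.
  elim: k => [|k IH]; first by rewrite big_ord0 mul0r sin0 expr0n.
  rewrite big_ord_recr /= IH.
  rewrite (_ : (2 * k + 1)%:R * t = k%:R * t + k.+1%:R * t); last by rewrite -natr1; ring.
  rewrite (_ : sin t = sin (k.+1%:R * t - k%:R * t)); last by congr sin; rewrite -natr1; ring.
  by rewrite sinB sinD; have := cos2Dsin2 (k%:R * t); have := cos2Dsin2 (k.+1%:R * t); nra.
elim: n => [|n IH]; first by rewrite !big_ord0.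
rewrite [RHS]big_ord_recr /= -IH -odd_sum [X in _ + X]big_ord_recr big_ord_recr /=.
rewrite subSnn mul1r addrA -big_split; congr (_ + _); apply: eq_bigr => i _ /=.
by rewrite subSn ?(ltnW (ltn_ord i)) // -natr1; ring.
Qed.

(* sin((2i+1)t) = sin((p-2i-1)t): of <2i+1> and <p-2i-1>, take the one whose index is
   at most (p-1)/2. *)
Definition fold_index (i : nat) : nat :=
  if (2 * i + 1 <= h.+1)%N then (2 * i + 1)%N else (2 * (h.+1 - i))%N.

(** At m = 1, <k> and <p-k> agree, so [fus_F] becomes the sum of <k>^2 for k from 1 to h + 1, with
    the weights of [sum_sin_weighted]; folding the indices brings the degree down to h. *)
Definition normF_poly : {poly int} := \sum_(i < h.+1) (h.+1 - i)%:R *: cheb (fold_index i).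

(** Folded indices are at most h + 1, and the coefficient of degree h is a sum of nonnegative terms,
    so one positive term suffices. *)
Lemma size_normF_poly : size normF_poly = h.+1.
Proof.
apply/eqP; rewrite eqn_leq; apply/andP; split.
  apply: (leq_trans (size_sum _ _ _)); apply/bigmax_leqP => i _.
  apply: (leq_trans (size_scale_leq _ _)); rewrite (size_cheb _).1.
  by rewrite /fold_index; case: ifP => //; lia.
rewrite ltnNge; apply/negP => /leq_sizeP /(_ _ (leqnn h)) /eqP.
rewrite coef_sum; under eq_bigr => i _.
  rewrite coefZ coef_cheb; last by rewrite /fold_index; case: ifP => //; lia.
  over.
(* This i folds to h + 1: as 2 i + 1 when h + 1 is odd, as 2 (h + 1 - i) when it is even. *)
have ih : (h.+1./2 < h.+1)%N by lia.
rewrite psumr_eq0 => [/allP /(_ (Ordinal ih))|i _]; last by rewrite mulr_ge0.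
rewrite mem_index_enum => /(_ isT) /=.
have -> : fold_index h.+1./2 = h.+1 by rewrite /fold_index; case: ifP; lia.
by rewrite eqxx mulr1 pnatr_eq0 subn_eq0 leqNgt ih.
Qed.

(** After multiplication by sin^2 t both sides equal p/4. *)
Lemma normF_horner : normF R p = (map_poly intr normF_poly).[normf R p].
Proof.
have p1 : (1 < p)%N by lia.
have s1 : 0 < sin t by have := @sin_gt0 1 p1; rewrite mul1r.
rewrite normfE; apply: (mulIf (x := sin t ^+ 2)); first by rewrite expf_neq0 // gt_eqF.
have -> : (map_poly intr normF_poly).[2 + 2 * cos t] * sin t ^+ 2 =
    \sum_(i < h.+1) sin (i.+1%:R * t) ^+ 2.
  rewrite -sum_sin_weighted /normF_poly rmorph_sum /= horner_sum mulr_suml; apply: eq_bigr => i _.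
  rewrite map_polyZ /= hornerZ rmorph_nat expr2 mulrA -[X in X * _]mulrA cheb_cos.
  congr (_ * _ * _); rewrite /fold_index; case: ifP => // _.
  rewrite (_ : (2 * (h.+1 - i))%:R * t = pi - (2 * i + 1)%:R * t).
    by rewrite sinB sinpi cospi; ring.
  rewrite -ptE p_halfR natrM natrB; first by rewrite natrD natrM; ring.
  exact: ltnW (ltn_ord i).
(* Since (2 h + 3) t = pi, the telescoped sum ends at sin pi = 0; splitting off its first term cos 0
   = 1 leaves - 1/2. *)
have C : \sum_(i < h.+1) cos (i.+1%:R * (2 * t)) = - 2^-1.
  have := sum_cos_even t h.+2; rewrite big_ord_recl /= mul0r cos0.
  under eq_bigr do rewrite /bump /= add1n.
  rewrite (_ : h.+2%:R * (2 * t) - t = pi); last by rewrite -ptE p_halfR -(natr1 h.+1); ring.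
  rewrite sinpi add0r => e; have n2 : 2 != 0 :> R by rewrite pnatr_eq0.
  have s0 : sin t != 0 by rewrite gt_eqF.
  by apply: (mulfI s0); apply: (mulfI n2); move: e; rewrite mulrA mulrDr; lra.
have E i : sin (i%:R * t) ^+ 2 = 2^-1 - 2^-1 * cos (i%:R * (2 * t)).
  have -> : i%:R * (2 * t) = (i%:R * t) *+ 2 by rewrite mulr2n; ring.
  by rewrite cos_mulr2n cos2sin2 mulr2n; field.
under eq_bigr do rewrite E.
rewrite big_split /= sumrN -mulr_sumr C sumr_const card_ord -[2^-1 *+ _]mulr_natr.
by rewrite /normF -/t p_halfR; field; rewrite gt_eqF.
Qed.

End Growth.

Theorem lemma1 (R : realType) (p : nat) (p_prime : prime p) (p_ge3 : (3 <= p)%N) :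
  [/\ grows_as (fun g => (dim_VI p g)%:~R : R) (normF R p),
      forall j : nat, (0 < j < p)%N ->
        grows_as (fun g => (dim_Vbar p g j)%:R : R) (normf R p) &
      exists2 r : {poly int}, size r = ((p - 3)./2).+1
        & normF R p = (map_poly intr r).[normf R p]].
Proof.
have p_odd : odd p by case: (even_prime p_prime) p_ge3 => [->|].
split; first exact: dim_VI_grows.
  by move=> j; exact: dim_Vbar_grows.
by exists (normF_poly p); [exact: size_normF_poly|exact: normF_horner].
Qed.
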